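(* Let $\Pi:\mathcal R\to S\times D^m$ be an $(s,t)$ family with first $(s,t)$ frame $\phi_1,\dots,\phi_{n+m}$, and let $\mathcal D=\cup_{k=1}^m\mathcal D_k$, $\mathcal D_k=\{t_k=0\}$, be the divisor of noded curves in $S\times D^m$. The log-cotangent bundle $\Omega_{S\times D^m}(\log\mathcal D)$ is generated by the first $(s,t)$ frame $\phi_1,\dots,\phi_{n+m}$. The conormal of $\mathcal D$ (along $\cap_{k=1}^m\mathcal D_k$, the annihilator of $\cap_{k=1}^mT_{\mathcal D_k}$) is generated by the elements $t_k\phi_{n+k}$, $1\le k\le m$, of the second $(s,t)$ frame.
   Context: **$(s,t)$ families.** Let $R$ be a compact (possibly disconnected) Riemann surface with distinct points formally paired $\{a_k,b_k\}_{k=1}^m$, such that identifying $a_k$ with $b_k$ for all $k$ gives a connected stable curve (each component of $R-\{a_k,b_k\}$ has negative Euler characteristic). Choose local coordinates $z_k$ near $a_k$, $z_k(a_k)=0$, $w_k$ near $b_k$, $w_k(b_k)=0$, with mutually disjoint domains, and Beltrami differentials $\nu_1,\dots,\nu_n$ giving a basis of $H^{0,1}_{\bar\partial}(R,\mathcal E(K^{-1}\prod_k a_k^{-1}b_k^{-1}))$ (smooth vector fields vanishing at the $a_k,b_k$) with supports disjoint from the coordinate domains. For $s$ in a small connected neighborhood $S$ of $0\in\mathbb C^n$, $R_s$ is $R$ with the complex structure given by local solutions of $w_{\bar z}=\nu(s)w_z$, $\nu(s)=\sum_j s_j\nu_j$; the $z_k,w_k$ remain holomorphic on $R_s$. Choose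 $0<c<1$ with $\{|z_k|<c\},\{|w_k|<c\}$ in the coordinate domains; put $D=\{|t|<c^4\}$. Remove the discs $\{|z_k|\le c^2\},\{|w_k|\le c^2\}$ from $R_s$, and for $(s,t)\in S\times D^m$ glue, for each $k$, a copy of $\{zw=t_k,|z|<c,|w|<c\}$ by identifying $p$ with $c^2<|z_k(p)|<c$ to $(z_k(p),t_k/z_k(p))$ and $q$ with $c^2<|w_k(q)|<c$ to $(t_k/w_k(q),w_k(q))$. The resulting proper family $\Pi:\mathcal R\to S\times D^m$ is an $(s,t)$ family. The general fiber is a smooth surface of genus $\mathbf g$ and $m+n=3\mathbf g-3$. Near the $k$-th node, $(z_k,w_k)$ with $z_kw_k=t_k$ and the remaining base parameters $s'$ are coordinates. **Relative dualizing sheaf and $\operatorname{Laur}$.** $\omega=\omega_{\mathcal R/S\times D^m}$ is the relative dualizing sheaf, generated near the $k$-th node by $\frac{dz_k}{z_k}-\frac{dw_k}{w_k}$. A section of $\omega^2$ near the $k$-th node is $\mathbf f(z_k,w_k,s')\big(\frac{dz_k}{z_k}-\frac{dw_k}{w_k}\big)^2$, $\mathbf f=\sum_{p,q\ge0} a_{pq}(s')z_k^pw_k^q$; its residue at the node is $a_{00}(s')$ and $\operatorname{Laur}_k:=4\sum_{p\ge0}a_{pp}(s')t_k^p$. $\mathcal V\subset\omega^2$ is the subsheaf of sections with vanishing residues at all nodes. **Pairing and identification with cotangents.** At a base point with all $t_k\neq0$, a tangent vector $v$ has a Kodaira-Spencer class represented by a Beltrami differential $\nu(z)\partial_z\otimes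 d\bar z$ on the fiber, and $(v,\phi)=\int\nu(z)\phi(z)\,dE$ for $\phi(z)dz^2$ the restriction of a section $\phi$ of $\Pi_*\omega^2$, $dE$ Euclidean area. Where all $t_k\ne0$, sections of $\Pi_*\omega^2=\Pi_*\mathcal V$ are thereby identified with $1$-forms on the base; this extends to an identification of $\Pi_*\mathcal V$ with the cotangent sheaf of $S\times D^m$, and sections of $\Pi_*\omega^2$ are considered as meromorphic $1$-forms on the base by the same identification off $\mathcal D$. **Frames.** The base is restricted to a neighborhood of the origin on which there are sections $\phi_1,\dots,\phi_{3\mathbf g-3}$ of $\Pi_*\omega^2$ with, where all $t_k\ne0$, $(\partial/\partial s_h,\phi_j)=\delta_{hj}$, $(\partial/\partial s_h,\phi_{n+k})=0$, and with $\operatorname{Laur}_k(\phi_h)=0$, $\operatorname{Laur}_k(\phi_{n+\ell})=-\delta_{k\ell}/\pi$ ($1\le h,j\le n$, $1\le k,\ell\le m$). These are the first $(s,t)$ frame; $\phi_1,\dots,\phi_n,t_1\phi_{n+1},\dots,t_m\phi_{n+m}$ is the second $(s,t)$ frame. **Log-cotangent and conormal.** $\Omega_M(\log\mathcal D)$ for a normal crossing divisor $\mathcal D=\cup_{k}\{z_{n+k}=0\}$ is the sheaf of meromorphic $1$-forms locally generated over $\mathcal O_M$ by $dz_j$, $dz_{n+k}/z_{n+k}$, $1\le j\le n$, $1\le k\le m$. The conormal at a point of $\cap_{k}\mathcal D_k$ is the space of cotangent vectors of $M$ annihilating $\cap_kT_{\mathcal D_k}$. *)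

(* Defs.v *)
From HB Require Import structures.
From mathcomp Require Import all_boot all_order all_algebra.
From mathcomp Require Import complex.
From mathcomp Require Import all_classical all_reals all_analysis.
Import Order.TTheory GRing.Theory Num.Theory.
Import numFieldNormedType.Exports.

Set Implicit Arguments.
Unset Strict Implicit.
Unset Printing Implicit Defensive.

Local Open Scope classical_set_scope.
Local Open Scope ring_scope.
Local Open Scope complex_scope.

(* Typing R[i] as a [numFieldType] gives it its norm topology and makes
   [derivable] and [differentiable] mean complex differentiability. *)
Definition Cx (R : realType) : numFieldType := R[i].

Section Calculus.
Variable R : realType.
Local Notation C := (Cx R).

Definition mkC (x y : R) : C := x +i* y.
Definition toC (x : R) : C := mkC x 0.
Definition reC (z : C) : R := complex.Re z.
Definition imC (z : C) : R := complex.Im z.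
Definition conjC (z : C) : C := conjc z.
Definition iC : C := mkC 0 1.

(* Derivatives along the real line [t |-> z + t d]. *)
Definition rline (f : C -> C) (d z : C) (t : R) : C := f (z + toC t * d).

Definition rderivable (f : C -> C) (d z : C) : Prop :=
  derivable (reC \o rline f d z) 0 1 /\ derivable (imC \o rline f d z) 0 1.

Definition rder (f : C -> C) (d z : C) : C :=
  mkC (derive1 (reC \o rline f d z) 0) (derive1 (imC \o rline f d z) 0).

Fixpoint Ck (k : nat) (U : set C) (f : C -> C) : Prop :=
  if k is k'.+1 then
    [/\ (forall z, U z -> {for z, continuous f}),
        (forall z, U z -> rderivable f 1 z /\ rderivable f iC z),
        Ck k' U (rder f 1) & Ck k' U (rder f iC)]
  else forall z, U z -> {for z, continuous f}.

(* Smoothness in the real sense; only meant for open [U]. *)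
Definition smooth (U : set C) (f : C -> C) : Prop := forall k, Ck k U f.

Definition d_z (f : C -> C) (z : C) : C := (rder f 1 z - iC * rder f iC z) / 2%:R.
Definition d_zbar (f : C -> C) (z : C) : C := (rder f 1 z + iC * rder f iC z) / 2%:R.

(* [f] is absolutely integrable over [A] for Euclidean area, with integral [v]. *)
Definition has_integral (A : set C) (f : C -> C) (v : C) : Prop :=
  let mu := (@lebesgue_measure R \x @lebesgue_measure R)%E in
  let D := [set u : R * R | A (mkC u.1 u.2)] in
  let fr := fun u : R * R => reC (f (mkC u.1 u.2)) in
  let fi := fun u : R * R => imC (f (mkC u.1 u.2)) in
  [/\ mu.-integrable D (EFin \o fr), mu.-integrable D (EFin \o fi)
    & v = mkC (Rintegral mu D fr) (Rintegral mu D fi)].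

End Calculus.

Section RiemannSurfaces.
Variable R : realType.
Local Notation C := (Cx R).

Record chart (X : topologicalType) := Chart {
  ch_dom : set X;
  ch_map :> X -> C;
  ch_inv : C -> X }.

Definition ch_im (X : topologicalType) (c : chart X) : set C := c @` ch_dom c.

Definition is_chart (X : topologicalType) (c : chart X) : Prop :=
  [/\ open (ch_dom c), open (ch_im c),
      (forall p, ch_dom c p -> ch_inv c (c p) = p),
      (forall p, ch_dom c p -> {for p, continuous (ch_map c)})
    & (forall z, ch_im c z -> {for z, continuous (ch_inv c)})].

Definition transition (X : topologicalType) (c d : chart X) : C -> C :=
  d \o ch_inv c.

Definition compatible (X : topologicalType) (c d : chart X) : Prop :=
  forall p, ch_dom c p -> ch_dom d p -> derivable (transition c d) (c p) 1.

Record compact_riemann_surface := CompactRiemannSurface {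
  rs_space :> topologicalType;
  rs_hausdorff : hausdorff_space rs_space;
  rs_compact : compact [set: rs_space];
  rs_size : nat;
  rs_atlas : 'I_rs_size -> chart rs_space;
  rs_atlasP : forall i, is_chart (rs_atlas i);
  rs_compat : forall i j, compatible (rs_atlas i) (rs_atlas j);
  rs_cover : forall p, exists i, ch_dom (rs_atlas i) p }.

Variable X : compact_riemann_surface.

Definition holo_chart (c : chart X) : Prop :=
  is_chart c /\
  forall i, compatible c (@rs_atlas X i) /\ compatible (@rs_atlas X i) c.

Definition chart_part (c : chart X) (A : set X) : set C :=
  [set z | ch_im c z /\ A (ch_inv c z)].

(* Expressions T dz^a dzbar^b: [T c] is the coefficient in the coordinate [c],
   and only its values on [ch_im c] are meaningful.  Vector fields have type
   (-1,0), Beltrami differentials (-1,1), quadratic differentials (2,0). *)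
Definition field : Type := chart X -> C -> C.

Definition is_tensor (a : int) (b : nat) (A : set X) (T : field) : Prop :=
  forall c d, holo_chart c -> holo_chart d ->
  forall p, A p -> ch_dom c p -> ch_dom d p ->
    let g' := derive1 (transition c d) (c p) in
    T c (c p) = T d (d p) * g' ^ a * conjC g' ^+ b.

Definition smooth_field (A : set X) (T : field) : Prop :=
  forall c, holo_chart c -> smooth (chart_part c A) (T c).

Definition vanishes_on (A : set X) (T : field) : Prop :=
  forall c, holo_chart c -> forall z, chart_part c A z -> T c z = 0.

Definition holo_form (T : field) : Prop :=
  is_tensor 1 0 setT T /\
  forall c, holo_chart c -> forall z, ch_im c z -> derivable (T c) z 1.

Definition is_component (Y : set X) : Prop :=
  exists p, Y = connected_component [set: X] p.

(* The genus of a component is the dimension of its space of holomorphic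
   1-forms, extended by zero to the other components. *)
Definition has_genus (Y : set X) (g : nat) : Prop :=
  exists w : 'I_g -> field,
    (forall i, holo_form (w i) /\ vanishes_on (~` Y) (w i)) /\
    forall T, holo_form T -> vanishes_on (~` Y) T ->
      exists! l : 'rV[C]_g, forall c, holo_chart c -> forall z, ch_im c z ->
        T c z = \sum_i l 0 i * w i c z.

(* Integral over [A] of a 2-form h dE.  The finite atlas cuts the surface into
   the disjoint pieces dom_i \ (dom_0 u ... u dom_(i-1)). *)
Definition cell (i : 'I_(@rs_size X)) : set X :=
  [set p | ch_dom (rs_atlas i) p /\
           forall j : 'I_(@rs_size X), (j < i)%N -> ~ ch_dom (rs_atlas j) p].

Definition has_surface_integral (A : set X) (h : field) (v : C) : Prop :=
  exists x : 'I_(@rs_size X) -> C,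
    (forall i, has_integral (chart_part (rs_atlas i) (cell i `&` A))
                            (h (rs_atlas i)) (x i)) /\
    v = \sum_i x i.

End RiemannSurfaces.

Arguments field {R} X.

Section Families.
Variable R : realType.
Local Notation C := (Cx R).

(* The data of an (s,t) family: m pairs of points to be glued into nodes and n
   Beltrami differentials. *)
Record st_family (n m : nat) := STFamily {
  fam_X :> compact_riemann_surface R;
  fam_a : 'I_m -> fam_X;
  fam_b : 'I_m -> fam_X;
  fam_a_inj : injective fam_a;
  fam_b_inj : injective fam_b;
  fam_ab : forall k l, fam_a k <> fam_b l;
  (* R / (a_k ~ b_k) is connected and nonempty *)
  fam_nonempty : exists p : fam_X, True;
  fam_connected : forall A : set fam_X, open A -> open (~` A) ->
    (forall k, A (fam_a k) <-> A (fam_b k)) -> A = set0 \/ A = setT;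
  (* 2 - 2g - #(marked points) < 0 on each component *)
  fam_stable : forall Y : set fam_X, is_component Y ->
    exists2 g, has_genus Y g &
      (2 < 2 * g + (#|[set k | fam_a k \in Y]%SET|
                    + #|[set k | fam_b k \in Y]%SET|))%N;
  fam_z : 'I_m -> chart R fam_X;
  fam_w : 'I_m -> chart R fam_X;
  fam_zP : forall k, [/\ holo_chart (fam_z k), ch_dom (fam_z k) (fam_a k)
                       & fam_z k (fam_a k) = 0];
  fam_wP : forall k, [/\ holo_chart (fam_w k), ch_dom (fam_w k) (fam_b k)
                       & fam_w k (fam_b k) = 0];
  fam_zz : forall k l, k <> l -> ch_dom (fam_z k) `&` ch_dom (fam_z l) = set0;
  fam_ww : forall k l, k <> l -> ch_dom (fam_w k) `&` ch_dom (fam_w l) = set0;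
  fam_zw : forall k l, ch_dom (fam_z k) `&` ch_dom (fam_w l) = set0;
  fam_nu : 'I_n -> field fam_X;
  fam_nu_smooth : forall j, smooth_field setT (fam_nu j);
  fam_nu_tensor : forall j, is_tensor (- 1) 1 setT (fam_nu j);
  (* the supports avoid the (open) coordinate domains *)
  fam_nu_supp : forall j k, vanishes_on (ch_dom (fam_z k)) (fam_nu j) /\
                            vanishes_on (ch_dom (fam_w k)) (fam_nu j);
  (* their classes form a basis of the Beltrami differentials modulo dbar of
     the smooth vector fields vanishing at the marked points *)
  fam_nu_basis : forall mu : field fam_X,
    smooth_field setT mu -> is_tensor (- 1) 1 setT mu ->
    exists! l : 'rV[C]_n, exists V : field fam_X,
      [/\ smooth_field setT V, is_tensor (- 1) 0 setT V,
          (forall k, vanishes_on [set fam_a k; fam_b k] V)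
        & forall c, holo_chart c -> forall z, ch_im c z ->
            mu c z = \sum_j l 0 j * fam_nu j c z + d_zbar (V c) z];
  fam_S : set 'rV[C]_n;
  fam_S_open : open fam_S;
  fam_S_conn : connected fam_S;
  fam_S0 : fam_S 0;
  fam_nu_small : forall s, fam_S s ->
    forall c, holo_chart c -> forall z, ch_im c z ->
      `|\sum_j s 0 j * fam_nu j c z| < 1;
  fam_c : R;
  fam_c_gt0 : 0 < fam_c;
  fam_c_lt1 : fam_c < 1;
  fam_c_z : forall k z, `|z| < toC fam_c -> ch_im (fam_z k) z;
  fam_c_w : forall k z, `|z| < toC fam_c -> ch_im (fam_w k) z }.

Arguments fam_a {n m}.
Arguments fam_b {n m}.
Arguments fam_z {n m}.
Arguments fam_w {n m}.
Arguments fam_nu {n m}.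
Arguments fam_S {n m}.
Arguments fam_c {n m}.

Variables (n m : nat).

(* C^n x C^m, with points b = (s, t).  It also serves as tangent space, and as
   cotangent space in the coframe ds_1..ds_n, dt_1..dt_m (see [ev]). *)
Definition stspace : normedModType C := ('rV[C]_n * 'rV[C]_m)%type.

Variable F : st_family n m.

Definition s_ (b : stspace) : 'rV[C]_n := b.1.
Definition t_ (b : stspace) (k : 'I_m) : C := b.2 0 k.
Definition d_ds (h : 'I_n) : stspace := (delta_mx 0 h, 0).
Definition cds (h : 'I_n) : stspace := (delta_mx 0 h, 0).
Definition cdt (k : 'I_m) : stspace := (0, delta_mx 0 k).

Definition ev (xi v : stspace) : C :=
  \sum_h xi.1 0 h * v.1 0 h + \sum_k xi.2 0 k * v.2 0 k.

(* A neighborhood S' x {|t_k| < r} of the origin in S x D^m, D = {|t| < c^4}. *)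
Definition restricted (S' : set 'rV[C]_n) (r : R) : Prop :=
  [/\ open S', connected S', S' 0, S' `<=` fam_S F & 0 < r <= fam_c F ^+ 4].

Definition base (S' : set 'rV[C]_n) (r : R) : set stspace :=
  [set b | S' (s_ b) /\ forall k, `|t_ b k| < toC r].

Definition Dk (k : 'I_m) : set stspace := [set b | t_ b k = 0].
Definition Ddiv : set stspace := [set b | exists k, Dk k b].

Definition nu_ (s : 'rV[C]_n) : field F :=
  fun c z => \sum_j s 0 j * fam_nu F j c z.

(* Tensors on R_s are written in the coordinates z of R, as T (dz + nu dzbar)^j
   with nu = nu(s).  For a local solution w of w_zbar = nu w_z one has
   dw = w_z (dz + nu dzbar), so that f(w) dw^j has T = f(w) w_z^j, and
     T_zbar - nu T_z - j nu_z T = w_z^j (d_zbar - nu d_z) (f(w)).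
   This is therefore the dbar operator of K^j on R_s: at j = 0 its vanishing is
   the equation f_zbar = nu f_z of the holomorphic functions of R_s. *)
Definition dbar_s (s : 'rV[C]_n) (j : int) (T : field F) : field F :=
  fun c z => d_zbar (T c) z - nu_ s c z * d_z (T c) z
             - j%:~R * d_z (nu_ s c) z * T c z.

(* R_s minus the closed discs of radius c^2. *)
Definition bulk : set F :=
  [set p | forall k,
    ~ (ch_dom (fam_z F k) p /\ `|fam_z F k p| <= toC (fam_c F ^+ 2)) /\
    ~ (ch_dom (fam_w F k) p /\ `|fam_w F k p| <= toC (fam_c F ^+ 2))].

(* The plumbing collar {z w = t_k, |z|, |w| < c} is parametrized by z; its part
   not identified with a part of [bulk] is the closed annulus [core]. *)
Definition collar (b : stspace) (k : 'I_m) : set C :=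
  [set z | [/\ z != 0, `|z| < toC (fam_c F) & `|t_ b k / z| < toC (fam_c F)]].
Definition core (b : stspace) (k : 'I_m) : set C :=
  [set z | [/\ z != 0, `|z| <= toC (fam_c F ^+ 2)
             & `|t_ b k / z| <= toC (fam_c F ^+ 2)]].

Definition overlap : set C :=
  [set z | toC (fam_c F ^+ 2) < `|z| /\ `|z| < toC (fam_c F)].

(* Points (z, w, b) around the k-th node; the entry t_k of b is disregarded,
   being equal to z w. *)
Definition near_node (S' : set 'rV[C]_n) (r : R) (z w : C) (b : stspace) : Prop :=
  [/\ `|z| < toC (fam_c F), `|w| < toC (fam_c F), `|z * w| < toC r
    & base S' r b].

(* A section over [base S' r] of the direct image of omega^2.
   - [qs_bulk c z b] is the coefficient of (dz + nu dzbar)^2 on [bulk]; it is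
     holomorphic on the total space: along R_s, and in b at a fixed point of R
     (the solutions w(z,s) being holomorphic in s).
   - [qs_node k z w b] is the coefficient of (dz/z - dw/w)^2 at the k-th node;
     it does not depend on t_k, and [qs_coef] are its Taylor coefficients.
   On the fiber zw = t_k one has dz/z - dw/w = 2 dz/z = - 2 dw/w. *)
Record qsection (S' : set 'rV[C]_n) (r : R) := QSection {
  qs_bulk : chart R F -> C -> stspace -> C;
  qs_node : 'I_m -> C -> C -> stspace -> C;
  qs_coef : 'I_m -> nat -> nat -> stspace -> C;
  qs_tensor : forall b, base S' r b ->
    is_tensor 2 0 bulk (fun c z => qs_bulk c z b : C);
  qs_smooth : forall b, base S' r b ->
    smooth_field bulk (fun c z => qs_bulk c z b : C);
  qs_dbar : forall b, base S' r b ->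
    vanishes_on bulk (dbar_s (s_ b) 2 (fun c z => qs_bulk c z b : C));
  qs_holo : forall c, holo_chart c -> forall z, chart_part c bulk z ->
    forall b, base S' r b -> differentiable (qs_bulk c z : stspace -> C) b;
  qs_cont : forall c, holo_chart c -> forall z, chart_part c bulk z ->
    forall b, base S' r b ->
    {for (z, b), continuous (fun y : C * stspace => qs_bulk c y.1 y.2)};
  qs_node_holo : forall k z w b, near_node S' r z w b ->
    differentiable (fun y : C * C * stspace => qs_node k y.1.1 y.1.2 y.2)
                   (z, w, b);
  qs_node_indep : forall k z w b b',
    near_node S' r z w b -> near_node S' r z w b' ->
    s_ b = s_ b' -> (forall l, l != k -> t_ b l = t_ b' l) ->
    qs_node k z w b = qs_node k z w b';
  qs_node_abs : forall k z w b, near_node S' r z w b -> exists M : C, forall N,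
    \sum_(p < N) \sum_(q < N) `|qs_coef k p q b * z ^+ p * w ^+ q| <= M;
  qs_node_series : forall k z w b, near_node S' r z w b ->
    (fun N => \sum_(p < N) \sum_(q < N) qs_coef k p q b * z ^+ p * w ^+ q : C)
      @ \oo --> qs_node k z w b;
  qs_glue_z : forall k z b, base S' r b -> overlap z ->
    qs_bulk (fam_z F k) z b = qs_node k z (t_ b k / z) b * (2%:R / z) ^+ 2;
  qs_glue_w : forall k w b, base S' r b -> overlap w ->
    qs_bulk (fam_w F k) w b = qs_node k (t_ b k / w) w b * (- 2%:R / w) ^+ 2 }.

Section Sections.
Variables (S' : set 'rV[C]_n) (r : R).
Implicit Type phi : qsection S' r.

Definition has_Laur phi (k : 'I_m) (b : stspace) (x : C) : Prop :=
  (fun N => 4%:R * \sum_(p < N) qs_coef phi k p p b * t_ b k ^+ p : C)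
    @ \oo --> x.

(* A smooth lift of the base tangent vector v to the fiber over b (t_k <> 0).
   - On [bulk]: v, keeping the point of R fixed, plus the vertical field of
     coefficient [V] in the frame dual to dz + nu dzbar.
   - On the k-th collar: al d/dz + be d/dw + (other components of v), where
     zw = t_k forces al w + be z = v_(t_k); so [al k] determines be.
   The two agree on the overlaps, where al, resp. be, is the coefficient of V in
   the coordinate z_k, resp. w_k. *)
Definition lift (b v : stspace) (V : field F) (al : 'I_m -> C -> C) : Prop :=
  [/\ smooth_field bulk V, is_tensor (- 1) 0 bulk V,
      (forall k, smooth (collar b k) (al k)),
      (forall k z, collar b k z -> overlap z -> al k z = V (fam_z F k) z)
    & (forall k z, collar b k z -> overlap (t_ b k / z) ->
         al k z * (t_ b k / z) + V (fam_w F k) (t_ b k / z) * z = t_ v k)].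

(* dbar of the vertical part of a lift is a Beltrami differential representing
   the Kodaira-Spencer class of v.  On [bulk], in a coordinate w(z,s) of the
   family, the vertical part is (sum_h v_(s_h) w_(s_h) + V w_z) d/dw, and
   differentiating w_zbar = nu(s) w_z gives the following coefficient, expressed
   so that its product with that of a quadratic differential is a density dE in
   the coordinate z. *)
Definition KS_bulk (b v : stspace) (V : field F) : field F :=
  fun c z => nu_ (s_ v) c z + dbar_s (s_ b) (- 1) V c z.

Definition KS_core (al : 'I_m -> C -> C) (k : 'I_m) (z : C) : C :=
  d_zbar (al k) z.

(* (v, phi) = x.  The integral over the fiber does not depend on the
   representative of the Kodaira-Spencer class, i.e. on the lift (Stokes); as it
   is the disjoint union of [bulk] and the [core]s, it is a sum. *)
Definition pairing (b v : stspace) phi (x : C) : Prop :=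
  exists V al, lift b v V al /\
  exists x0 (x_ : 'I_m -> C),
    [/\ has_surface_integral bulk
          (fun c z => KS_bulk b v V c z * qs_bulk phi c z b) x0,
        (forall k, has_integral (core b k)
          (fun z => KS_core al k z *
                    (qs_node phi k z (t_ b k / z) b * (2%:R / z) ^+ 2)) (x_ k))
      & x = x0 + \sum_k x_ k].

(* The 1-form, on the complement of the divisor, identified with [phi]. *)
Definition form_of phi (eta : stspace -> stspace) : Prop :=
  forall b, base S' r b -> ~ Ddiv b -> forall v, pairing b v phi (ev (eta b) v).

Definition first_frame (phi : 'I_(n + m) -> qsection S' r) : Prop :=
  [/\ (forall b, base S' r b -> ~ Ddiv b -> forall h j : 'I_n,
         pairing b (d_ds h) (phi (lshift m j)) (h == j)%:R),
      (forall b, base S' r b -> ~ Ddiv b -> forall (h : 'I_n) (k : 'I_m),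
         pairing b (d_ds h) (phi (rshift n k)) 0),
      (forall b, base S' r b -> forall (k : 'I_m) (h : 'I_n),
         has_Laur (phi (lshift m h)) k b 0)
    & (forall b, base S' r b -> forall k l : 'I_m,
         has_Laur (phi (rshift n l)) k b (- (k == l)%:R / toC pi))].

End Sections.

(* [theta] is, on U, a section of the O-module of meromorphic 1-forms locally
   generated by e.  Forms are compared off the divisor. *)
Definition generated (N : nat) (e : 'I_N -> stspace -> stspace)
    (U : set stspace) (theta : stspace -> stspace) : Prop :=
  forall b0, U b0 -> exists (W : set stspace) (g : 'I_N -> stspace -> C),
    [/\ open W, W b0,
        (forall j b, W b -> differentiable (g j) b)
      & forall b, W b -> ~ Ddiv b -> theta b = \sum_j g j b *: e j b].

Definition log_generators (j : 'I_(n + m)) (b : stspace) : stspace :=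
  match fintype.split j with
  | inl h => cds h
  | inr k => (t_ b k)^-1 *: cdt k
  end.

Definition log_cotangent := generated log_generators.

(* T_(D_k) is the kernel of dt_k. *)
Definition conormal (xi : stspace) : Prop :=
  forall v : stspace, (forall k, ev (cdt k) v = 0) -> ev xi v = 0.

End Families.

(* Main.v *)
(* Let [phi_1, ..., phi_(n+m)] be the first frame.  The 1-forms identified with
   it are exactly ds_1, ..., ds_n, dt_1/t_1, ..., dt_m/t_m, from which everything
   follows.  The first frame prescribes the pairings with the d/ds_h.  As for
   d/dt_k, a lift that vanishes on the bulk is given on the k-th collar by the
   field (z / t_k) h(|z|^2) d/dz, with h a cutoff between the squared radii of
   the boundary circles of the core, and its dbar is (z^2 / t_k) h'(|z|^2).
   Expanding the section as sum a_pq z^p (t_k/z)^q, which converges boundedly on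
   the core, the pairing becomes a sum of integrals of z^(p-q) h'(|z|^2).  Those
   with p <> q vanish, because the integrand is an angular derivative; those with
   p = q are equal to -pi, because 2 h'(|z|^2) is the divergence of
   (h(|z|^2) - 1) (x, y) / |z|^2.  Hence (d/dt_k, phi) = - pi Laur_k(phi) / t_k. *)
Require Import Defs.
From HB Require Import structures.
From mathcomp Require Import all_boot all_order all_algebra.
From mathcomp Require Import complex.
From mathcomp Require Import all_classical all_reals all_analysis.
From mathcomp Require Import measurable_realfun ring lra.
Import Order.TTheory GRing.Theory Num.Theory.
Import numFieldNormedType.Exports.
Set Implicit Arguments.
Unset Strict Implicit.
Unset Printing Implicit Defensive.
Local Open Scope classical_set_scope.
Local Open Scope ring_scope.

(** * Real and imaginary parts *)

(** [pairing] asks for some lift, so a convenient one may be chosen: on each collar the cutoff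
    interpolates between moving t_k with w fixed (inner side) and with z fixed (outer side), and
    both ends match the zero field on the bulk. Everything then happens on the plane annulus [core].
    The obstacle is to integrate there without polar coordinates or a Stokes formula on a domain
    with curved boundary. As h' vanishes outside the annulus, which lies in the unit disc because c
    < 1, each integral equals one over the square [-1, 1]^2, where Green's formula is Fubini plus
    the one-variable fundamental theorem. The price is that integrands must be smooth on the whole
    square, even at the origin where 1/z and 1/|z|^2 are singular; hence an algebra of smooth
    expressions that contains cutoffs, and a regularized 1/|z|^2. The constant pi enters through the
    sides of the square, along which the flux integrates to an arctangent. *)

Section ComplexParts.
Variable R : realType.
Local Notation C := (Cx R).
Implicit Types z w : C.

Lemma mkC_eta z : mkC (reC z) (imC z) = z. Proof. by case: z. Qed.
Lemma eqC z w : reC z = reC w -> imC z = imC w -> z = w.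
Proof. by case: z w => [a b] [c d] /= -> ->. Qed.
Lemma reCD z w : reC (z + w) = reC z + reC w. Proof. by case: z w => [? ?] []. Qed.
Lemma imCD z w : imC (z + w) = imC z + imC w. Proof. by case: z w => [? ?] []. Qed.
Lemma reCN z : reC (- z) = - reC z. Proof. by case: z. Qed.
Lemma imCN z : imC (- z) = - imC z. Proof. by case: z. Qed.
Lemma reCB z w : reC (z - w) = reC z - reC w. Proof. by rewrite reCD reCN. Qed.
Lemma imCB z w : imC (z - w) = imC z - imC w. Proof. by rewrite imCD imCN. Qed.
Lemma reCM z w : reC (z * w) = reC z * reC w - imC z * imC w.
Proof. by case: z w => [? ?] []. Qed.
Lemma imCM z w : imC (z * w) = reC z * imC w + imC z * reC w.
Proof. by case: z w => [? ?] []. Qed.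

Lemma toCD (a b : R) : toC (a + b) = toC a + toC b.
Proof. exact: (rmorphD (real_complex R)). Qed.
Lemma toC_sum (T : Type) (s : seq T) (P : pred T) (f : T -> R) :
  toC (\sum_(i <- s | P i) f i) = \sum_(i <- s | P i) toC (f i).
Proof. by apply: (big_morph _ toCD). Qed.
Lemma toCM (a b : R) : toC (a * b) = toC a * toC b.
Proof. by apply: eqC; rewrite ?reCM ?imCM /=; ring. Qed.
Lemma toCX (a : R) n : toC (a ^+ n) = toC a ^+ n.
Proof. by elim: n => // n IH; rewrite !exprS toCM IH. Qed.
Lemma toCV (a : R) : toC a^-1 = (toC a)^-1.
Proof. exact: (fmorphV (real_complex R)). Qed.
Lemma toC_nat n : toC (n%:R : R) = n%:R.
Proof. exact: (rmorph_nat (real_complex R)). Qed.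
Lemma toC_eq0 (a : R) : (toC a == 0) = (a == 0).
Proof. exact: (fmorph_eq0 (real_complex R)). Qed.

Lemma ltC_toC (a b : R) : (toC a < toC b) = (a < b). Proof. exact: ltcR. Qed.
Lemma leC_toC (a b : R) : (toC a <= toC b) = (a <= b). Proof. exact: lecR. Qed.

Lemma toC_gt0 (a : R) : (0 < toC a) = (0 < a). Proof. exact: (ltC_toC 0 a). Qed.

(** The norm of [C] takes its values in [C]; estimates and integrals over R need a modulus with real
    values. *)
Definition modC z : R := Num.sqrt (reC z ^+ 2 + imC z ^+ 2).

Lemma normCE z : `|z| = toC (modC z). Proof. exact: normc_def. Qed.

Lemma modC_ge0 z : 0 <= modC z. Proof. exact: sqrtr_ge0. Qed.

Lemma sqr_modC z : modC z ^+ 2 = reC z ^+ 2 + imC z ^+ 2.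
Proof. by rewrite sqr_sqrtr// addr_ge0// sqr_ge0. Qed.

Lemma toC_inj : injective (@toC R). Proof. exact: complexI. Qed.

Lemma modCM z w : modC (z * w) = modC z * modC w.
Proof. by apply: toC_inj; rewrite toCM -!normCE normrM. Qed.
Lemma modCX z n : modC (z ^+ n) = modC z ^+ n.
Proof. by apply: toC_inj; rewrite toCX -!normCE normrX. Qed.
Lemma modCV z : modC z^-1 = (modC z)^-1.
Proof. by apply: toC_inj; rewrite toCV -!normCE normfV. Qed.
Lemma modC_eq0 z : (modC z == 0) = (z == 0).
Proof. by rewrite -toC_eq0 -normCE normr_eq0. Qed.
Lemma modC_gt0 z : (0 < modC z) = (z != 0).
Proof. by rewrite lt_def modC_ge0 modC_eq0 andbT. Qed.
Lemma modC_toC (a : R) : 0 <= a -> modC (toC a) = a.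
Proof. by move=> a0; rewrite /modC /= expr0n addr0 sqrtr_sqr ger0_norm. Qed.

Lemma le_modCD z w : modC (z + w) <= modC z + modC w.
Proof.
rewrite -leC_toC -normCE (le_trans (ler_normD _ _))// !normCE.
by rewrite toCD.
Qed.
Lemma le_modC_sum (T : Type) (s : seq T) (f : T -> C) :
  modC (\sum_(i <- s) f i) <= \sum_(i <- s) modC (f i).
Proof.
elim: s => [|i s IH]; first by rewrite !big_nil /modC /= expr0n addr0 sqrtr0.
by rewrite !big_cons (le_trans (le_modCD _ _))// lerD2l.
Qed.

Lemma mulC_conj z : z * conjC z = toC (modC z ^+ 2).
Proof. by rewrite sqr_modC; case: z => a b; apply: eqC => /=; ring. Qed.

Lemma le_reC z : `|reC z| <= modC z.
Proof.
rewrite -(@ler_pXn2r _ 2)// ?nnegrE ?modC_ge0// sqr_modC.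
by rewrite real_normK ?num_real// lerDl sqr_ge0.
Qed.
Lemma le_imC z : `|imC z| <= modC z.
Proof.
rewrite -(@ler_pXn2r _ 2)// ?nnegrE ?modC_ge0// sqr_modC.
by rewrite real_normK ?num_real// lerDr sqr_ge0.
Qed.
Lemma le_modC z : modC z <= `|reC z| + `|imC z|.
Proof.
rewrite -(@ler_pXn2r _ 2)// ?nnegrE ?modC_ge0 ?addr_ge0//.
by rewrite sqr_modC sqrrD !real_normK ?num_real// addrAC lerDl mulrn_wge0// mulr_ge0.
Qed.

Lemma continuous_reC : continuous (@reC R).
Proof.
move=> z; apply/(@cvgrPdist_lt _ _ _ (nbhs z)) => e e0; near=> w.
rewrite -reCB (le_lt_trans (le_reC _))// -ltC_toC -normCE.
near: w; exists (toC e) => //=; rewrite toC_gt0.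
Unshelve. all: by end_near. Qed.

Lemma continuous_imC : continuous (@imC R).
Proof.
move=> z; apply/(@cvgrPdist_lt _ _ _ (nbhs z)) => e e0; near=> w.
rewrite -imCB (le_lt_trans (le_imC _))// -ltC_toC -normCE.
near: w; exists (toC e) => //=; rewrite toC_gt0.
Unshelve. all: by end_near. Qed.

Lemma cvg_mkC (T : Type) (F : set_system T) {FF : Filter F} (f g : T -> R) (a b : R) :
  f @ F --> a -> g @ F --> b -> (fun t => mkC (f t) (g t) : C) @ F --> (mkC a b : C).
Proof.
move=> fa gb; apply/cvgrPdist_lt => e e0.
(* In the partial order of [C] a positive element is real, so the epsilon descends to R. *)
have [r er] : exists r : R, e = toC r.
  by exists (reC e); apply: eqC => //; exact: (ger0_Im (ltW e0)).
have r0 : 0 < r by rewrite -toC_gt0 -er.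
near=> t; rewrite normCE er ltC_toC (le_lt_trans (le_modC _))//.
rewrite reCB imCB /= [ltRHS]splitr ltrD//; near: t.
  by apply: cvgr_dist_lt => //; rewrite divr_gt0.
by apply: cvgr_dist_lt => //; rewrite divr_gt0.
Unshelve. all: by end_near. Qed.

End ComplexParts.

(** * Smooth functions of the plane *)

Section Flat.
Variable R : realType.
Implicit Types (p : {poly R}) (x y : R).

(** The polynomial factor in 1/x makes the family closed under differentiation: the derivative
    replaces p by X^2 (p - p'). *)
Definition flat p x : R := if 0 < x then p.[x^-1] * expR (- x^-1) else 0.

Lemma flat0 p x : x <= 0 -> flat p x = 0.
Proof. by rewrite /flat leNgt => /negbTE ->. Qed.

(** With y = 1/x this is y^(n+1) / (n+1)! <= exp y, a single term of the exponential series; the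
    extra degree supplies the factor x. *)
Lemma Xn_expRN n x : 0 < x -> x^-1 ^+ n * expR (- x^-1) <= n.+1`!%:R * x.
Proof.
move=> x0; rewrite expRN ler_pdivrMr ?expR_gt0//.
have y0 : 0 < x^-1 by rewrite invr_gt0.
have := @expR_ge1Dxn _ x^-1 n (ltW y0) => /(le_trans _) H.
have {H} : x^-1 ^+ n.+1 / n.+1`!%:R <= expR x^-1 by apply: H; rewrite lerDr.
rewrite ler_pdivrMr ?ltr0n ?fact_gt0// => H.
rewrite -mulrA -[leLHS]mul1r -[in leLHS](@mulfV _ x) ?gt_eqF// -mulrA -exprS.
rewrite mulrCA ler_pM2l// mulrC; exact: H.
Qed.

Lemma flat_le p : exists C, forall x, `|flat p x| <= C * `|x|.
Proof.
exists (\sum_(i < size p) `|p`_i| * i.+1`!%:R) => x.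
rewrite /flat; case: ifPn => [x0|_]; last first.
  by rewrite normr0 mulr_ge0// sumr_ge0// => i _; rewrite mulr_ge0.
rewrite horner_coef mulr_suml mulr_suml (le_trans (ler_norm_sum _ _ _))//.
apply: ler_sum => i _; rewrite -mulrA normrM -mulrA ler_wpM2l//.
rewrite ger0_norm; last by rewrite mulr_ge0 ?expR_ge0// exprn_ge0// invr_ge0 ltW.
by rewrite (ger0_norm (ltW x0)) Xn_expRN.
Qed.

Lemma flatX p x : flat ('X * p) x = x^-1 * flat p x.
Proof.
by rewrite /flat; case: ifP => _; rewrite ?mulr0// hornerM hornerX mulrA.
Qed.

Lemma is_derive_flat p x : is_derive x 1 (flat p) (flat ('X^2 * (p - p^`())) x).
Proof.
have [x0|x0|->] := ltgtP x 0.
- rewrite (flat0 _ (ltW x0)); apply: (@near_eq_is_derive _ _ _ (cst 0)).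
    by near=> y; rewrite flat0//; near: y; apply: filterS (lt_nbhsl x0) => y /ltW.
- apply: (@near_eq_is_derive _ _ _ (fun x => p.[x^-1] * expR (- x^-1))).
    by near=> y; rewrite /flat ifT//; near: y; exact: lt_nbhsr.
  have xn0 : x != 0 by rewrite gt_eqF.
  have dV : is_derive x 1 (fun y : R => y^-1) (- x ^- 2).
    by apply: is_derive_eq; first exact: (is_deriveV xn0); rewrite /GRing.scale/= mulr1.
  have dp := is_derive1_comp (is_derive_poly p x^-1) dV.
  have de := @is_derive1_comp _ expR (fun y : R => - y^-1) _ _ _
    (is_derive_expR (- x^-1)) (is_deriveN dV).
  refine (is_derive_eq (is_deriveM dp de) _).
  rewrite /flat x0 /GRing.scale/= !(hornerM, hornerX, hornerD, hornerN) -exprVn; ring.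
- rewrite (flat0 _ (lexx 0)).
  (* At 0 the difference quotient is itself [flat ('X * p)], which the linear bound squeezes to
     0. *)
  have [C HC] := flat_le ('X * p).
  suff H : h^-1 *: (flat p (h *: 1 + 0) - flat p 0) @[h --> 0^'] --> 0.
    by apply: DeriveDef; [apply/cvg_ex; exists 0 | exact/cvg_lim].
  rewrite flat0//.
  have C0 : C * `|h| @[h --> (0 : R)^'] --> 0.
    apply: cvg_within_filter.
    suff : C * `|h| @[h --> (0 : R)] --> C * 0 by rewrite mulr0.
    by apply: cvgM; [exact: cvg_cst | apply/norm_cvg0P; exact: cvg_id].
  apply: (@squeeze_cvgr _ _ _ _ (fun h => - (C * `|h|)) (fun h => C * `|h|)) => //.
    near=> h; rewrite addr0 subr0 /GRing.scale/= mulr1 -flatX.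
    by rewrite -ler_norml HC.
  by have := cvgN C0; rewrite oppr0; apply.
Unshelve. all: by end_near. Qed.

Lemma is_derive_flat_comp p (f : R -> R) x df : is_derive x 1 f df ->
  is_derive x 1 (fun x => flat p (f x)) (flat ('X^2 * (p - p^`())) (f x) * df).
Proof. exact: (is_derive1_comp (is_derive_flat p (f x))). Qed.

Lemma continuous_flat p : continuous (flat p).
Proof.
by move=> x; apply/differentiable_continuous/derivable1_diffP;
  case: (is_derive_flat p x).
Qed.

Lemma flat_gt0 x : 0 < x -> 0 < flat 1 x.
Proof. by move=> x0; rewrite /flat x0 hornerC mul1r expR_gt0. Qed.

Lemma flat1_ge0 x : 0 <= flat 1 x.
Proof. by rewrite /flat; case: ifP => // _; rewrite hornerC mul1r expR_ge0. Qed.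

Lemma le_flat x y : x <= y -> flat 1 x <= flat 1 y.
Proof.
move=> xy; have [x0|x0] := ltP 0 x; last by rewrite (flat0 _ x0) flat1_ge0.
have y0 := lt_le_trans x0 xy.
by rewrite /flat x0 y0 !hornerC !mul1r ler_expR lerN2 lef_pV2.
Qed.

End Flat.

Section PlaneFunctions.
Variable R : realType.
Implicit Types f g : R -> R -> R.

(* An algebra of smooth functions of the plane, generated by expressions, that
   is stable under partial derivatives and contains cutoff functions. *)
Inductive smexp : (R -> R -> R) -> Prop :=
| smexp_cst c : smexp (fun _ _ => c)
| smexp_x : smexp (fun x _ => x)
| smexp_y : smexp (fun _ y => y)
| smexpD f g : smexp f -> smexp g -> smexp (fun x y => f x y + g x y)
| smexpM f g : smexp f -> smexp g -> smexp (fun x y => f x y * g x y)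
| smexp_flat p f : smexp f -> smexp (fun x y => flat p (f x y))
| smexpV f : smexp f -> (forall x y, 0 < f x y) ->
    smexp (fun x y => (f x y)^-1).

Lemma smexpZ c f : smexp f -> smexp (fun x y => c * f x y).
Proof. by apply: smexpM; apply: smexp_cst. Qed.

Lemma smexpN f : smexp f -> smexp (fun x y => - f x y).
Proof.
move=> /(smexpZ (-1)); congr smexp; apply/funext => x; apply/funext => y.
by rewrite mulN1r.
Qed.

Lemma smexpB f g : smexp f -> smexp g -> smexp (fun x y => f x y - g x y).
Proof. by move=> sf /smexpN; apply: smexpD. Qed.

Lemma smexpX f n : smexp f -> smexp (fun x y => f x y ^+ n).
Proof.
move=> sf; elim: n => [|n IH]; first exact: smexp_cst.
have := smexpM sf IH; congr smexp; apply/funext => x; apply/funext => y.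
by rewrite exprS.
Qed.

Lemma smexp_swap f : smexp f -> smexp (fun x y => f y x).
Proof.
elim=> [c|||g h _ sg _ sh|g h _ sg _ sh|p g _ sg|g _ sg g0].
- exact: smexp_cst.
- exact: smexp_y.
- exact: smexp_x.
- exact: smexpD.
- exact: smexpM.
- exact: smexp_flat.
- by apply: smexpV => // x y; exact: g0.
Qed.

Lemma smexp_dx f : smexp f ->
  exists2 g, smexp g & forall x y : R, is_derive x (1 : R) (f^~ y) (g x y).
Proof.
elim=> [c|||g h sg [g' sg' dg] sh [h' sh' dh]|g h sg [g' sg' dg] sh [h' sh' dh]
       |p g sg [g' sg' dg]|g sg [g' sg' dg] g0].
- by exists (fun _ _ => 0) => [|x y]; [exact: smexp_cst | exact: is_derive_cst].
- by exists (fun _ _ => 1) => [|x y]; [exact: smexp_cst | exact: is_derive_id].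
- by exists (fun _ _ => 0) => [|x y]; [exact: smexp_cst | exact: is_derive_cst].
- exists (fun x y => g' x y + h' x y) => [|x y]; first exact: smexpD.
  exact: is_deriveD.
- exists (fun x y => g x y * h' x y + h x y * g' x y) => [|x y].
    by apply: smexpD; apply: smexpM.
  exact: is_deriveM.
- exists (fun x y => flat ('X^2 * (p - p^`())) (g x y) * g' x y) => [|x y].
    by apply: smexpM => //; apply: smexp_flat.
  exact: is_derive_flat_comp.
- exists (fun x y => - (g x y)^-1 ^+ 2 * g' x y) => [|x y].
    by apply: smexpM => //; apply: smexpN; apply: smexpX; apply: smexpV.
  rewrite exprVn; apply: is_deriveV; rewrite ?gt_eqF//; exact: g0.
Qed.

Lemma smexp_dy f : smexp f ->
  exists2 g, smexp g & forall x y : R, is_derive y (1 : R) (f x) (g x y).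
Proof.
by move=> /smexp_swap/smexp_dx[g /smexp_swap sg dg]; exists (fun x y => g y x).
Qed.

Lemma smexp_continuous f : smexp f -> continuous (fun u : R * R => f u.1 u.2).
Proof.
elim=> [c|||g h _ sg _ sh|g h _ sg _ sh|p g _ sg|g _ sg g0] u.
- exact: cvg_cst.
- exact: cvg_fst.
- exact: cvg_snd.
- by apply: cvgD; [exact: sg|exact: sh].
- by apply: cvgM; [exact: sg|exact: sh].
- by apply: (@continuous_comp _ _ _ _ (flat p)); [exact: sg|exact: continuous_flat].
- by apply: cvgV; [rewrite gt_eqF|exact: sg].
Qed.

Lemma smexp_measurable f : smexp f ->
  measurable_fun setT
    (fun u : measurableTypeR R * measurableTypeR R => f u.1 u.2).
Proof.
elim=> [c|||g h _ sg _ sh|g h _ sg _ sh|p g _ sg|g _ sg g0].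
- exact: measurable_cst.
- exact: measurable_fst.
- exact: measurable_snd.
- exact: measurable_funD.
- exact: measurable_funM.
- apply: measurableT_comp => //; apply: continuous_measurable_fun.
  exact: continuous_flat.
(* Positivity turns the inverse into exp (- ln g), a composite of measurable functions. *)
- rewrite [X in measurable_fun _ X](_ : _ = expR \o (-%R \o (@ln R \o
    (fun u : measurableTypeR R * measurableTypeR R => g u.1 u.2)))).
    apply: measurableT_comp => //; apply: measurableT_comp => //.
    by apply: measurableT_comp => //; exact: measurable_ln.
  by apply/funext => u /=; rewrite expRN lnK// posrE g0.
Qed.

End PlaneFunctions.

(** * Green's formula on a square *)

Section Green.
Variable R : realType.
Local Notation mu := (@lebesgue_measure R).
Local Notation mu2 := (mu \x mu)%E.
Local Notation RR := (measurableTypeR R * measurableTypeR R)%type.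
Local Notation I := (`[(-1 : R), 1]%classic).
Local Notation Q := (I `*` I).
Implicit Types f g : R -> R -> R.

Lemma smexp_bounded f : smexp f ->
  exists M, forall x y, I x -> I y -> `|f x y| <= M.
Proof.
move=> sf; have cQ : compact Q by apply: compact_setX; exact: segment_compact.
have cf : {within Q, continuous (fun u : R * R => f u.1 u.2)}.
  by apply: continuous_subspaceT; exact: smexp_continuous.
have /compact_bounded := continuous_compact cf cQ.
move=> /ex_strict_bound_gt0[M _ HM].
by exists M => x y Ix Iy; apply/ltW/HM; exists (x, y).
Qed.

Lemma measurable_square : measurable (Q : set RR).
Proof. by apply: measurableX; exact: measurable_itv. Qed.

Lemma smexp_integrable (A : set RR) f : measurable A -> A `<=` Q ->
  smexp f -> mu2.-integrable A (EFin \o (fun u => f u.1 u.2)).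
Proof.
move=> mA AQ sf; apply: (integrableS measurable_square) => //.
apply: measurable_bounded_integrable.
- exact: measurable_square.
- have : (mu2 Q = mu I * mu I)%E by apply: product_measure1E; exact: measurable_itv.
  by move=> /= ->; rewrite lebesgue_measure_itv /= lte_fin ltrNl opprK; case: ifP;
    rewrite -?EFinM ltry.
- by apply: measurable_funTS; exact: smexp_measurable.
- have [M HM] := smexp_bounded sf.
  exists M; split; first exact: num_real.
  by move=> N MN u [/= u1 u2]; rewrite (le_trans (HM _ _ u1 u2))// ltW.
Qed.

(** Fubini is applied to the extension by zero to the plane, whose slices are the extensions by zero
    of the slices. Both orders are recorded because Green's formula integrates each partial
    derivative first in its own variable. *)
Lemma smexp_fubini f : smexp f ->
  (\int[mu2]_(u in Q) (f u.1 u.2)%:E = \int[mu]_(y in I) \int[mu]_(x in I) (f x y)%:E)%E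
  /\ (\int[mu2]_(u in Q) (f u.1 u.2)%:E = \int[mu]_(x in I) \int[mu]_(y in I) (f x
    y)%:E)%E.
Proof.
move=> sf; have := smexp_integrable measurable_square (@subset_refl _ _) sf.
move=> /(integrable_mkcond _ measurable_square) iQ.
rewrite [in X in X /\ _]integral_mkcond [in X in _ /\ X]integral_mkcond.
split; [rewrite -(integral21_prod_meas1 iQ)|rewrite -(integral12_prod_meas1 iQ)];
  rewrite [RHS]integral_mkcond; apply: eq_integral => t _ /=.
- rewrite /fubini_G patchE; case: ifPn => [tI|tI].
    rewrite [RHS]integral_mkcond; apply: eq_integral => s _.
    rewrite !patchE; case: ifPn => [|/negP sI].
      by rewrite inE => -[sI _]; rewrite ifT//; exact/mem_set.
    by rewrite ifF//; apply/negP => sI'; apply: sI; rewrite inE; split => /=;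
      exact/set_mem.
  rewrite integral0_eq// => s _; rewrite patchE ifF//; apply/negP.
  by rewrite inE => -[_ /mem_set]; apply/negP.
- rewrite /fubini_F patchE; case: ifPn => [tI|tI].
    rewrite [RHS]integral_mkcond; apply: eq_integral => s _.
    rewrite !patchE; case: ifPn => [|/negP sI].
      by rewrite inE => -[_ sI]; rewrite ifT//; exact/mem_set.
    by rewrite ifF//; apply/negP => sI'; apply: sI; rewrite inE; split => /=;
      exact/set_mem.
  rewrite integral0_eq// => s _; rewrite patchE ifF//; apply/negP.
  by rewrite inE => -[/mem_set H _]; move: H; apply/negP.
Qed.

Lemma smexp_FTC f g y : smexp g ->
  (forall x y : R, is_derive x (1 : R) (f^~ y) (g x y)) ->
  (\int[mu]_(x in I) (g x y)%:E = (f 1 y - f (-1) y)%:E)%E.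
Proof.
move=> sg fg.
have cg : continuous (g^~ y).
  move=> x; apply: (@continuous_comp _ _ _ (fun x => (x, y)) (fun u => g u.1 u.2)).
    exact: (cvg_pair (@cvg_id _ (nbhs x)) (cvg_cst y)).
  exact: smexp_continuous.
have cf : continuous (f^~ y).
  by move=> x; apply/differentiable_continuous/derivable1_diffP; case: (fg x y).
rewrite (@continuous_FTC2 _ (g^~ y) (f^~ y)) ?EFinB//.
- exact: continuous_subspaceT.
- split; first by move=> x _; case: (fg x y).
    by apply: cvg_at_right_filter; exact: cf.
  by apply: cvg_at_left_filter; exact: cf.
- by move=> x _; rewrite derive1E; case: (fg x y).
Qed.

(** One half of Green's formula: an x-derivative only sees the two sides x = 1 and x = -1. *)
Lemma green_x f g : smexp g ->
  (forall x y : R, is_derive x (1 : R) (f^~ y) (g x y)) ->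
  (\int[mu2]_(u in Q) (g u.1 u.2)%:E = \int[mu]_(y in I) (f 1 y - f (-1) y)%:E)%E.
Proof.
move=> sg fg; rewrite (smexp_fubini sg).1; apply: eq_integral => y _.
exact: smexp_FTC.
Qed.

Lemma green_y f g : smexp g ->
  (forall x y : R, is_derive y (1 : R) (f x) (g x y)) ->
  (\int[mu2]_(u in Q) (g u.1 u.2)%:E = \int[mu]_(x in I) (f x 1 - f x (-1))%:E)%E.
Proof.
move=> sg fg; rewrite (smexp_fubini sg).2; apply: eq_integral => x _.
exact: (@smexp_FTC (fun x y => f y x) (fun x y => g y x) x (smexp_swap sg)
  (fun a b => fg b a)).
Qed.

End Green.

(** * Angular derivatives *)

Section Rotation.
Variable R : realType.
Local Notation mu := (@lebesgue_measure R).
Local Notation mu2 := (mu \x mu)%E.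
Local Notation I := (`[(-1 : R), 1]%classic).
Local Notation Q := (I `*` I).
Implicit Types f g : R -> R -> R.

(* [g] is the derivative of [f] along the divergence-free field
   x d/dy - y d/dx. *)
Definition angular f g := smexp f /\ exists fx fy, [/\ smexp fx, smexp fy,
  (forall x y : R, is_derive x (1 : R) (f^~ y) (fx x y)),
  (forall x y : R, is_derive y (1 : R) (f x) (fy x y))
  & forall x y, x * fy x y - y * fx x y = g x y].

Lemma eq_angular f g f' g' : f =2 f' -> g =2 g' -> angular f g -> angular f' g'.
Proof.
move=> ff' gg'; have -> : f' = f by apply/funext => x; apply/funext => y.
by have -> : g' = g by apply/funext => x; apply/funext => y.
Qed.

Lemma angular_cst c : angular (fun _ _ => c) (fun _ _ => 0).
Proof.
split; first exact: smexp_cst.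
exists (fun _ _ => 0), (fun _ _ => 0); split; try exact: smexp_cst.
- by move=> x y; exact: is_derive_cst.
- by move=> x y; exact: is_derive_cst.
- by move=> x y; rewrite !mulr0 subr0.
Qed.

Lemma angular_x : angular (fun x _ => x) (fun _ y => - y).
Proof.
split; first exact: smexp_x.
exists (fun _ _ => 1), (fun _ _ => 0); split; try exact: smexp_cst.
- by move=> x y; exact: is_derive_id.
- by move=> x y; exact: is_derive_cst.
- by move=> x y; rewrite mulr0 mulr1 sub0r.
Qed.

Lemma angular_y : angular (fun _ y => y) (fun x _ => x).
Proof.
split; first exact: smexp_y.
exists (fun _ _ => 0), (fun _ _ => 1); split; try exact: smexp_cst.
- by move=> x y; exact: is_derive_cst.
- by move=> x y; exact: is_derive_id.
- by move=> x y; rewrite mulr0 mulr1 subr0.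
Qed.

Lemma angularD f f' g g' : angular f f' -> angular g g' ->
  angular (fun x y => f x y + g x y) (fun x y => f' x y + g' x y).
Proof.
move=> [sf [fx [fy [sfx sfy dfx dfy ff']]]] [sg [gx [gy [sgx sgy dgx dgy gg']]]].
split; first exact: smexpD.
exists (fun x y => fx x y + gx x y), (fun x y => fy x y + gy x y).
split; try exact: smexpD.
- by move=> x y; exact: is_deriveD.
- by move=> x y; exact: is_deriveD.
- by move=> x y; rewrite -ff' -gg'; ring.
Qed.

Lemma angularM f f' g g' : angular f f' -> angular g g' ->
  angular (fun x y => f x y * g x y) (fun x y => f x y * g' x y + g x y * f' x y).
Proof.
move=> [sf [fx [fy [sfx sfy dfx dfy ff']]]] [sg [gx [gy [sgx sgy dgx dgy gg']]]].
split; first exact: smexpM.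
exists (fun x y => f x y * gx x y + g x y * fx x y).
exists (fun x y => f x y * gy x y + g x y * fy x y).
split; try by apply: smexpD; apply: smexpM.
- by move=> x y; exact: is_deriveM.
- by move=> x y; exact: is_deriveM.
- by move=> x y; rewrite -ff' -gg'; ring.
Qed.

(** Rotation invariance in infinitesimal form: for angular differentiation, a radial factor behaves
    like a constant. *)
Definition radial f := angular f (fun _ _ => 0).

Lemma radial_smexp f : radial f -> smexp f. Proof. by case. Qed.

Lemma radialM f g : radial f -> radial g -> radial (fun x y => f x y * g x y).
Proof. by move=> rf rg; apply: eq_angular (angularM rf rg) => x y //;
  rewrite !mulr0 addr0. Qed.

Lemma radialD f g : radial f -> radial g -> radial (fun x y => f x y + g x y).
Proof. by move=> rf rg; apply: eq_angular (angularD rf rg) => x y //;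
  rewrite addr0. Qed.

Lemma radialZ c f : radial f -> radial (fun x y => c * f x y).
Proof. by apply: radialM; exact: angular_cst. Qed.

Lemma radialX f n : radial f -> radial (fun x y => f x y ^+ n).
Proof.
move=> rf; elim: n => [|n IH]; first exact: angular_cst.
by apply: eq_angular (radialM rf IH) => x y //; rewrite exprS.
Qed.

Lemma radial_flat p f : radial f -> radial (fun x y => flat p (f x y)).
Proof.
move=> [sf [fx [fy [sfx sfy dfx dfy ff']]]]; split; first exact: smexp_flat.
exists (fun x y => flat ('X^2 * (p - p^`())) (f x y) * fx x y).
exists (fun x y => flat ('X^2 * (p - p^`())) (f x y) * fy x y); split.
- by apply: smexpM => //; exact: smexp_flat.
- by apply: smexpM => //; exact: smexp_flat.
- by move=> x y; exact: is_derive_flat_comp.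
- by move=> x y; exact: is_derive_flat_comp.
- by move=> x y; rewrite mulrCA (mulrCA y) -mulrBr ff' mulr0.
Qed.

Lemma radialV f : radial f -> (forall x y, 0 < f x y) ->
  radial (fun x y => (f x y)^-1).
Proof.
move=> [sf [fx [fy [sfx sfy dfx dfy ff']]]] f0; split; first exact: smexpV.
exists (fun x y => - (f x y)^-1 ^+ 2 * fx x y).
exists (fun x y => - (f x y)^-1 ^+ 2 * fy x y); split.
- by apply: smexpM => //; apply: smexpN; apply: smexpX; exact: smexpV.
- by apply: smexpM => //; apply: smexpN; apply: smexpX; exact: smexpV.
- by move=> x y; rewrite exprVn; apply: is_deriveV; rewrite ?gt_eqF//; exact: f0.
- by move=> x y; rewrite exprVn; apply: is_deriveV; rewrite ?gt_eqF//; exact: f0.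
- by move=> x y; rewrite mulrCA (mulrCA y) -mulrBr ff' mulr0.
Qed.

Lemma radial_norm2 : radial (fun x y => x ^+ 2 + y ^+ 2).
Proof.
apply: eq_angular (angularD (angularM angular_x angular_x) (angularM angular_y
  angular_y)) => x y //=; ring.
Qed.

(** The rotation field has no divergence, so g = d(x f)/dy - d(y f)/dx; by Green only values of f on
    the sides of the square remain, and these lie outside the open unit disc, where f is 0. *)
Lemma Rintegral_angular f g : angular f g -> smexp g ->
  (forall x y : R, 1 <= x ^+ 2 + y ^+ 2 -> f x y = 0) ->
  Rintegral mu2 Q (fun u => g u.1 u.2) = 0.
Proof.
move=> [sf [fx [fy [sfx sfy dfx dfy ff']]]] sg f0.
have sgy : smexp (fun x y => x * fy x y) by apply: smexpM => //; exact: smexp_x.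
have sgx : smexp (fun x y => y * fx x y) by apply: smexpM => //; exact: smexp_y.
have dgx (x y : R) : is_derive x (1 : R) (fun x => y * f x y) (y * fx x y).
  by apply: is_deriveZ.
have dgy (x y : R) : is_derive y (1 : R) (fun y => x * f x y) (x * fy x y).
  by apply: is_deriveZ.
have -> : (fun u : R * R => g u.1 u.2) =
  (fun u => u.1 * fy u.1 u.2 - u.2 * fx u.1 u.2).
  by apply/funext => u; rewrite ff'.
have ge1 (y : R) : 1 <= 1 ^+ 2 + y ^+ 2 by rewrite expr1n lerDl sqr_ge0.
have geN1 (y : R) : 1 <= (-1) ^+ 2 + y ^+ 2 by rewrite sqrrN.
rewrite RintegralB.
- rewrite /Rintegral (green_x sgx dgx) (green_y sgy dgy).
  rewrite (eq_integral (cst 0%E)); last first.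
    by move=> y _; rewrite !f0 ?mulr0 ?subrr// addrC.
  rewrite integral0 (eq_integral (cst 0%E)) ?integral0 ?subrr//.
  by move=> y _; rewrite !f0 ?mulr0 ?subrr.
- exact: measurable_square.
- exact: (smexp_integrable (@measurable_square R) (@subset_refl _ _) sgy).
- exact: (smexp_integrable (@measurable_square R) (@subset_refl _ _) sgx).
Qed.

End Rotation.

(** * Integrals of a radial cutoff *)

Section Cutoff.
Variable R : realType.
Local Notation C := (Cx R).
Local Notation mu := (@lebesgue_measure R).
Local Notation mu2 := (mu \x mu)%E.
Local Notation I := (`[(-1 : R), 1]%classic).
Local Notation Q := (I `*` I).
Variables u1 u2 : R.
Hypotheses (u1_gt0 : 0 < u1) (u1u2 : u1 < u2) (u2_le1 : u2 <= 1).

Local Notation flat1 := (flat (1 : {poly R})).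
Local Notation dflat1 := (flat ('X^2 * (1 - 1^`()) : {poly R})).
Local Notation a := (flat1 (u2 - u1)).

(** The inner flat function is 0 up to u1 and at least [a] from u2 on; the outer one converts this
    into the plateau 1 and then 0. Nesting, instead of the usual quotient f / (f + g), leaves a
    constant denominator. *)
Definition cutoff (u : R) : R := (flat1 a)^-1 * flat1 (a - flat1 (u - u1)).

(** The chain rule through both layers; one factor vanishes below u1 and the other above u2. *)
Definition dcutoff (u : R) : R :=
  - (flat1 a)^-1 * (dflat1 (a - flat1 (u - u1)) * dflat1 (u - u1)).

Let a_gt0 : 0 < a. Proof. by rewrite flat_gt0// subr_gt0. Qed.

Lemma cutoff1 u : u <= u1 -> cutoff u = 1.
Proof.
move=> uu1; rewrite /cutoff (@flat0 _ _ (u - u1)) ?subr_le0// subr0 mulVf//.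
by rewrite gt_eqF// flat_gt0.
Qed.

Lemma cutoff0 u : u2 <= u -> cutoff u = 0.
Proof.
by move=> uu2; rewrite /cutoff (@flat0 _ _ (a - _)) ?mulr0// subr_le0 le_flat// lerD2r.
Qed.

Lemma dcutoff_le u : u <= u1 -> dcutoff u = 0.
Proof. by move=> uu1; rewrite /dcutoff (@flat0 _ ('X^2 * _) (u - u1)) ?subr_le0//
  !mulr0. Qed.

Lemma dcutoff_ge u : u2 <= u -> dcutoff u = 0.
Proof.
move=> uu2; rewrite /dcutoff (@flat0 _ ('X^2 * _) (a - flat1 (u - u1))) ?mul0r ?mulr0//.
by rewrite subr_le0 le_flat// lerD2r.
Qed.

Lemma is_derive_cutoff (f : R -> R) (x df : R) : is_derive x (1 : R) f df ->
  is_derive x (1 : R) (cutoff \o f) (dcutoff (f x) * df).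
Proof.
move=> ff; have d1 : is_derive x (1 : R) (fun x => f x - u1) df.
  by apply: is_derive_eq; rewrite subr0.
have d2 := is_derive_flat_comp 1 d1.
have d3 : is_derive x (1 : R) (fun x => a - flat1 (f x - u1)) (- (dflat1 (f x - u1) *
  df)).
  by refine (is_derive_eq (is_deriveB (is_derive_cst a x 1) d2) _); rewrite sub0r.
have d4 := is_derive_flat_comp 1 d3.
refine (is_derive_eq (is_deriveZ (flat1 a)^-1 d4) _) => /=.
by rewrite /dcutoff /GRing.scale /=; ring.
Qed.

Local Notation N x y := (x ^+ 2 + y ^+ 2).

(** Equal to 1/|z|^2 as soon as |z|^2 >= u1; the flat term keeps the denominator positive at the
    origin. Below u1 it is always multiplied by a factor that vanishes there, [cutoff - 1] or
    [dcutoff]. *)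
Definition invN (x y : R) : R := (N x y + flat1 (u1 - N x y))^-1.

Lemma N_flat_gt0 x y : 0 < N x y + flat1 (u1 - N x y).
Proof.
have N0 : 0 <= N x y by rewrite addr_ge0// sqr_ge0.
have [NN|NN] := ltP (N x y) u1.
  by rewrite ltr_wpDl// flat_gt0// subr_gt0.
by rewrite ltr_pwDl ?flat1_ge0// (lt_le_trans u1_gt0).
Qed.

Lemma invNE x y : u1 <= N x y -> invN x y = (N x y)^-1.
Proof. by move=> uN; rewrite /invN flat0 ?addr0// subr_le0. Qed.

Lemma radial_invN : radial invN.
Proof.
apply: radialV; last exact: N_flat_gt0.
apply: radialD; first exact: radial_norm2.
apply: radial_flat; apply: radialD; first exact: angular_cst.
apply: (@eq_angular _ (fun x y => -1 * N x y) (fun _ _ => 0)) => //;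
  first by move=> x y; rewrite mulN1r.
by apply: radialZ; exact: radial_norm2.
Qed.

Lemma radial_dcutoff : radial (fun x y => dcutoff (N x y)).
Proof.
have r1 : radial (fun x y => N x y - u1).
  by apply: radialD; [exact: radial_norm2|exact: angular_cst].
rewrite /dcutoff; apply: radialZ; apply: radialM; last exact: radial_flat.
apply: radial_flat; apply: radialD; first exact: angular_cst.
apply: (@eq_angular _ (fun x y => -1 * flat1 (N x y - u1)) (fun _ _ => 0)) => //.
  by move=> x y; rewrite mulN1r.
by apply: radialZ; exact: radial_flat.
Qed.

Lemma smexp_cutoff : smexp (fun x y => cutoff (N x y)).
Proof.
have sN : smexp (fun x y : R => N x y) by exact: (radial_smexp (radial_norm2 R)).
rewrite /cutoff; apply: smexpZ; apply: smexp_flat; apply: smexpB.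
  exact: smexp_cst.
by apply: smexp_flat; apply: smexpB; [exact: sN|exact: smexp_cst].
Qed.

Lemma smexp_dcutoff : smexp (fun x y => dcutoff (N x y)).
Proof. exact: (radial_smexp radial_dcutoff). Qed.

Lemma is_derive_N (x y : R) : is_derive x (1 : R) (fun x => N x y) (2 * x).
Proof.
refine (is_derive_eq (is_deriveD (is_deriveM (is_derive_id x 1) (is_derive_id x 1))
  (is_derive_cst (y ^+ 2) x 1)) _).
by rewrite /GRing.scale /= !mulr1 addr0 mulr_natl mulr2n.
Qed.

(** The x-component of the radial field; the y-component is [G y x], so one derivative and one
    boundary integral serve for both. Subtracting 1 from the cutoff kills the field around the
    singularity of (x, y) / |z|^2. *)
Let G (x y : R) := (cutoff (N x y) - 1) * (x * invN x y).
Let dG (x y : R) := 2 * x ^+ 2 * dcutoff (N x y) * invN x y +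
  (cutoff (N x y) - 1) *
    (invN x y - 2 * x ^+ 2 * invN x y ^+ 2 * (1 - dflat1 (u1 - N x y))).

Lemma is_derive_G (x y : R) : is_derive x (1 : R) (G^~ y) (dG x y).
Proof.
have dN := is_derive_N x y.
have d1 : is_derive x (1 : R) (fun x => u1 - N x y) (- (2 * x)).
  by refine (is_derive_eq (is_deriveB (is_derive_cst u1 x 1) dN) _); rewrite sub0r.
have d2 := is_derive_flat_comp 1 d1.
have n0 : (fun x => N x y + flat1 (u1 - N x y)) x != 0 by rewrite gt_eqF// N_flat_gt0.
have d3 := @is_deriveV _ (fun x => N x y + flat1 (u1 - N x y)) _ _ _ n0
  (is_deriveD dN d2).
have d4 := is_deriveM (is_derive_id x 1) d3.
have d5 := is_deriveB (is_derive_cutoff dN) (is_derive_cst (1 : R) x 1).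
refine (is_derive_eq (is_deriveM d5 d4) _).
rewrite /GRing.scale /= !fctE /dG /invN -exprVn /=; ring.
Qed.

Lemma smexp_dG : smexp dG.
Proof.
have sN : smexp (fun x y : R => N x y) by exact: (radial_smexp (radial_norm2 R)).
have sV : smexp invN by exact: (radial_smexp radial_invN).
have s2 : smexp (fun x _ : R => 2 * x ^+ 2).
  by apply: smexpZ; apply: smexpX; exact: smexp_x.
apply: smexpD.
  by apply: smexpM => //; apply: smexpM => //; exact: smexp_dcutoff.
apply: smexpM; first by apply: smexpB; [exact: smexp_cutoff|exact: smexp_cst].
apply: smexpB => //; apply: smexpM; first by apply: smexpM => //; exact: smexpX.
apply: smexpB; first exact: smexp_cst.
by apply: smexp_flat; apply: smexpB; [exact: smexp_cst|].
Qed.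

(** Below u1 both sides are 0. Above, (x, y) / |z|^2 is divergence-free, so only the derivative of
    the cutoff contributes, namely 2 (x^2 + y^2) h' / |z|^2. *)
Lemma dG_div (x y : R) : dG x y + dG y x = 2 * dcutoff (N x y).
Proof.
rewrite /dG (addrC (y ^+ 2)) /invN (addrC (y ^+ 2)) -/(invN x y).
have [uN|/ltW uN] := leP (N x y) u1.
  by rewrite dcutoff_le// cutoff1// subrr !(mul0r, mulr0, addr0).
rewrite invNE// (@flat0 _ _ (u1 - _)) ?subr_le0//.
have N0 : N x y != 0 by rewrite gt_eqF// (lt_le_trans u1_gt0).
by field.
Qed.

Let N_ge1 (y : R) : 1 <= 1 ^+ 2 + y ^+ 2.
Proof. by rewrite expr1n lerDl sqr_ge0. Qed.

(** On the sides of the square |z|^2 >= 1 >= u2, so the cutoff is 0 there and the field is -(x, y) /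
    |z|^2. *)
Lemma G_boundary (y : R) : G 1 y - G (-1) y = -2 * (1 + y ^+ 2)^-1.
Proof.
have u2N : u2 <= 1 ^+ 2 + y ^+ 2 by rewrite (le_trans u2_le1).
have u1N : u1 <= 1 ^+ 2 + y ^+ 2 by rewrite (le_trans (ltW u1u2)).
rewrite /G /= /invN !sqrrN -/(invN 1 y) invNE// cutoff0// expr1n; ring.
Qed.

Lemma integral_G_boundary :
  (\int[mu]_(y in I) (G 1 y - G (-1) y)%:E = (- pi)%:E)%E.
Proof.
rewrite (@continuous_FTC2 _ _ (fun y => -2 * atan y)).
- rewrite -EFinB atanN atan1; congr EFin; by field.
- by [].
- apply: continuous_subspaceT => y.
  rewrite (_ : (fun y => _) = (fun y => -2 * (1 + y ^+ 2)^-1)); last first.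
    by apply/funext => z; exact: G_boundary.
  apply: cvgM; first exact: cvg_cst.
  apply: cvgV; first by rewrite gt_eqF// ltr_pwDl// sqr_ge0.
  apply: cvgD; first exact: cvg_cst.
  exact: exprn_continuous.
- have ct : continuous (fun y : R => -2 * atan y).
    by move=> y; apply: cvgM; [exact: cvg_cst|exact: continuous_atan].
  split; [|by apply: cvg_at_right_filter; exact: ct|by apply: cvg_at_left_filter;
    exact: ct].
  by move=> y _; apply: derivableM => //; exact: derivable_atan.
- move=> y _; rewrite G_boundary derive1E.
  have := is_deriveZ (-2) (is_derive1_atan y) => -[_ /=].
  by [].
Qed.

(** Each pair of opposite sides contributes -pi to the flux, and the divergence is twice the
    integrand. The result agrees with the polar value pi (h(1) - h(0)). *)
Lemma Rintegral_dcutoff :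
  Rintegral mu2 Q (fun u => dcutoff (N u.1 u.2)) = - pi.
Proof.
have iG := smexp_integrable (@measurable_square R) (@subset_refl _ _) smexp_dG.
have iG' := smexp_integrable (@measurable_square R) (@subset_refl _ _) (smexp_swap
  smexp_dG).
have iD := smexp_integrable (@measurable_square R) (@subset_refl _ _) smexp_dcutoff.
have : Rintegral mu2 Q (fun u => 2 * dcutoff (N u.1 u.2)) = - pi - pi.
  rewrite (_ : (fun u => _) = (fun u => dG u.1 u.2 + dG u.2 u.1)); last first.
    by apply/funext => u; rewrite dG_div.
  rewrite (RintegralD (@measurable_square R) iG iG') /Rintegral.
  rewrite (green_x smexp_dG is_derive_G).
  rewrite (green_y (smexp_swap smexp_dG) (fun x y => is_derive_G y x)).
  by rewrite integral_G_boundary.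
rewrite (RintegralZl _ (@measurable_square R) iD); lra.
Qed.

(* On the support of [dcutoff (N x y)] this is z^p (1/z)^q dcutoff (N x y). *)
Definition zmon p q (x y : R) : C :=
  mkC x y ^+ p * conjC (mkC x y) ^+ q * toC (invN x y ^+ q * dcutoff (N x y)).

Let mon p q (x y : R) : C := mkC x y ^+ p * conjC (mkC x y) ^+ q.

(** The real and imaginary parts of the rule that d/dtheta multiplies z^p zbar^q by i (p - q),
    proved by multiplying by one factor z or zbar at a time. *)
Lemma angular_mon p q :
  angular (fun x y => reC (mon p q x y)) (fun x y => (q%:R - p%:R) * imC (mon p q x y))
    /\
  angular (fun x y => imC (mon p q x y)) (fun x y => (p%:R - q%:R) * reC (mon p q x y)).
Proof.
elim: p => [|p [IH1 IH2]]; first (elim: q => [|q [IH1 IH2]]).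
- split; [apply: eq_angular (angular_cst (1 : R))|apply: eq_angular (angular_cst (0 :
    R))] => x y;
  by rewrite /mon !expr0 ?mulr1 ?subrr ?mul0r.
- have E x y : mon 0 q.+1 x y = mkC x (- y) * mon 0 q x y.
    by rewrite /mon !expr0 !mul1r exprS.
  split.
  + apply: eq_angular (angularD (angularM (angular_x R) IH1) (angularM (angular_y R)
      IH2)) => x y.
      by rewrite E reCM /=; ring.
    rewrite E imCM /= -(natr1 q); move: (reC _) (imC _) (q%:R) => b c d; ring.
  + have := angularD (angularM (angular_x R) IH2) (angularM (angular_cst (-1))
      (angularM (angular_y R) IH1)).
    apply: eq_angular => x y; first by rewrite E imCM /=; ring.
    rewrite E reCM /= -(natr1 q); move: (reC _) (imC _) (q%:R) => b c d; ring.
- have E x y : mon p.+1 q x y = mkC x y * mon p q x y by rewrite /mon exprS mulrA.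
  split.
  + have := angularD (angularM (angular_x R) IH1) (angularM (angular_cst (-1))
      (angularM (angular_y R) IH2)).
    apply: eq_angular => x y; first by rewrite E reCM /=; ring.
    rewrite E imCM /= -(natr1 p).
    move: (reC _) (imC _) (q%:R) (p%:R) => b c d e; ring.
  + apply: eq_angular (angularD (angularM (angular_x R) IH2) (angularM (angular_y R)
      IH1)) => x y.
      by rewrite E imCM /=; ring.
    rewrite E reCM /= -(natr1 p).
    move: (reC _) (imC _) (q%:R) (p%:R) => b c d e; ring.
Qed.

Let rad q (x y : R) := invN x y ^+ q * dcutoff (N x y).

Let radial_rad q : radial (rad q).
Proof. by apply: radialM; [apply: radialX; exact: radial_invN|exact: radial_dcutoff].
  Qed.

Lemma re_zmon p q x y : reC (zmon p q x y) = rad q x y * reC (mon p q x y).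
Proof. by rewrite reCM /= mulr0 subr0 mulrC. Qed.
Lemma im_zmon p q x y : imC (zmon p q x y) = rad q x y * imC (mon p q x y).
Proof. by rewrite imCM /= mulr0 add0r mulrC. Qed.

Lemma angular_zmon p q :
  angular (fun x y => reC (zmon p q x y)) (fun x y => (q%:R - p%:R) * imC (zmon p q x
    y)) /\
  angular (fun x y => imC (zmon p q x y)) (fun x y => (p%:R - q%:R) * reC (zmon p q x
    y)).
Proof.
split; [apply: eq_angular (angularM (radial_rad q) (angular_mon p q).1)
       |apply: eq_angular (angularM (radial_rad q) (angular_mon p q).2)] => x y;
  by rewrite ?re_zmon ?im_zmon//; ring.
Qed.

Lemma smexp_zmon p q : smexp (fun x y => reC (zmon p q x y)) /\
  smexp (fun x y => imC (zmon p q x y)).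
Proof. by have [[]? _ []] := angular_zmon p q. Qed.

Lemma zmon0 p q x y : ~ (u1 <= N x y <= u2) -> zmon p q x y = 0.
Proof.
move=> H; rewrite /zmon (_ : dcutoff _ = 0) ?mulr0//.
have [/dcutoff_le//|h1] := leP (N x y) u1.
have [/dcutoff_ge//|h2] := leP u2 (N x y).
by case: H; rewrite !ltW.
Qed.

Lemma zmon_diag p x y : zmon p p x y = toC (dcutoff (N x y)).
Proof.
have [uN|/ltW uN] := leP (N x y) u1; first by rewrite /zmon dcutoff_le// !mulr0.
have N0 : N x y != 0 by rewrite gt_eqF// (lt_le_trans u1_gt0).
rewrite /zmon -exprMn mulC_conj -toCX sqr_modC /= -toCM mulrA -exprMn invNE//.
by rewrite mulfV// expr1n mul1r.
Qed.

Lemma Rintegral_zmon p q :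
  Rintegral mu2 Q (fun u => reC (zmon p q u.1 u.2)) = - (p == q)%:R * pi /\
  Rintegral mu2 Q (fun u => imC (zmon p q u.1 u.2)) = 0.
Proof.
have [->|pq] := eqVneq p q.
  have -> : (fun u : R * R => reC (zmon q q u.1 u.2)) = (fun u => dcutoff (N u.1 u.2)).
    by apply/funext => u; rewrite zmon_diag.
  have -> : (fun u : R * R => imC (zmon q q u.1 u.2)) = (fun=> 0).
    by apply/funext => u; rewrite zmon_diag.
  by rewrite Rintegral_dcutoff mulN1r /Rintegral integral0.
have [sr si] := smexp_zmon p q; have [rr ri] := angular_zmon p q.
have z0 (x y : R) : 1 <= N x y -> zmon p q x y = 0.
  move=> N1; rewrite /zmon dcutoff_ge ?mulr0//; exact: le_trans N1.
have d0 : (p%:R - q%:R : R) != 0 by rewrite subr_eq0 eqr_nat.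
have d0' : (q%:R - p%:R : R) != 0 by rewrite subr_eq0 eqr_nat eq_sym.
have ir := smexp_integrable (@measurable_square R) (@subset_refl _ _) sr.
have ii := smexp_integrable (@measurable_square R) (@subset_refl _ _) si.
(* Up to the nonzero factors p - q and q - p, each part is the angular derivative of the other. *)
split.
- have := Rintegral_angular ri (smexpZ _ sr) (fun x y H => congr1 (@imC R) (z0 x y H)).
  by rewrite (RintegralZl _ (@measurable_square R) ir) => /eqP;
    rewrite mulf_eq0 (negPf d0) /= => /eqP ->; rewrite oppr0 mul0r.
- have := Rintegral_angular rr (smexpZ _ si) (fun x y H => congr1 (@reC R) (z0 x y H)).
  by rewrite (RintegralZl _ (@measurable_square R) ii) => /eqP;
    rewrite mulf_eq0 (negPf d0') /= => /eqP.
Qed.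

End Cutoff.

(** * Complex-valued smooth functions *)

Section RealDerivatives.
Variable R : realType.
Local Notation C := (Cx R).
Implicit Types (f g : C -> C) (d z : C) (U : set C).

Definition is_rder f d z (D : C) : Prop :=
  is_derive (0 : R) (1 : R) (@reC R \o rline f d z) (reC D) /\
  is_derive (0 : R) (1 : R) (@imC R \o rline f d z) (imC D).

Lemma is_rderP f d z : rderivable f d z -> is_rder f d z (rder f d z).
Proof. by move=> [df1 df2]; split; [apply: (DeriveDef df1)|apply: (DeriveDef df2)];
  exact/esym/derive1E. Qed.

Lemma is_rder_derivable f d z D : is_rder f d z D -> rderivable f d z.
Proof. by case=> -[d1 _] -[d2 _]; exact: conj d1 d2. Qed.

Lemma is_rderE f d z D : is_rder f d z D -> rder f d z = D.
Proof. by move=> [[_ H1] [_ H2]]; apply: eqC; rewrite /= derive1E. Qed.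

Lemma is_rder_lin (a : C) f g d z D E : is_rder f d z D -> is_rder g d z E ->
  is_rder (fun z => a * f z + g z) d z (a * D + E).
Proof.
move=> [f1 f2] [g1 g2]; split.
- rewrite (_ : @reC R \o _ = (reC a \*: (@reC R \o rline f d z) -
     imC a \*: (@imC R \o rline f d z)) + (@reC R \o rline g d z)).
    refine (is_derive_eq (is_deriveD (is_deriveB (is_deriveZ _ f1)
      (is_deriveZ _ f2)) g1) _).
    by rewrite reCD reCM.
  by apply/funext => t; rewrite !fctE /= /rline reCD reCM.
- rewrite (_ : @imC R \o _ = (reC a \*: (@imC R \o rline f d z) +
     imC a \*: (@reC R \o rline f d z)) + (@imC R \o rline g d z)).
    refine (is_derive_eq (is_deriveD (is_deriveD (is_deriveZ _ f2)
      (is_deriveZ _ f1)) g2) _).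
    by rewrite imCD imCM.
  by apply/funext => t; rewrite !fctE /= /rline imCD imCM.
Qed.

Lemma near_rline U d z : open U -> U z -> \forall t \near (0 : R), U (z + toC t * d).
Proof.
move=> oU Uz; have : (fun t : R => z + toC t * d) t @[t --> (0 : R)] --> z.
  rewrite -[X in _ --> X]addr0 -[X in _ --> _ + X](mul0r d).
  apply: cvgD; first exact: cvg_cst.
  apply: cvgM; last exact: cvg_cst.
  by apply: cvg_mkC; [exact: cvg_id|exact: cvg_cst].
by apply; apply: open_nbhs_nbhs.
Qed.

Lemma near_is_rder U f g d z D : open U -> U z -> {in U, f =1 g} ->
  is_rder f d z D -> is_rder g d z D.
Proof.
move=> oU Uz fg [f1 f2]; split; [apply: near_eq_is_derive f1|apply: near_eq_is_derive
  f2];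
  near=> t; rewrite /= /rline fg// inE; near: t; exact: near_rline.
Unshelve. all: by end_near. Qed.

Lemma eq_continuous_for U f g z : open U -> {in U, f =1 g} -> U z ->
  {for z, continuous f} -> {for z, continuous g}.
Proof.
move=> oU fg Uz cf; suff : g w @[w --> z] --> f z by rewrite fg ?inE.
apply: cvg_trans cf; apply: (@near_eq_cvg _ _ (nbhs z)); near=> w.
by apply: fg; rewrite inE; near: w; exact: open_nbhs_nbhs.
Unshelve. all: by end_near. Qed.

(** On an open set, derivatives depend only on the values in the set. This is needed since the
    formulas for [rder] of a combination hold only at points of [U], where the functions are
    derivable. *)
Lemma eq_Ck k U f g : open U -> {in U, f =1 g} -> Ck k U f -> Ck k U g.
Proof.
move=> oU; elim: k f g => [|k IH] f g fg /=.
  by move=> cf z Uz; exact: (eq_continuous_for oU fg Uz (cf z Uz)).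
move=> [cf df c1 c2]; have D d z (Uz : U z) : rderivable f d z ->
    is_rder g d z (rder f d z).
  by move=> /is_rderP; exact: (near_is_rder oU Uz fg).
split.
- by move=> z Uz; exact: (eq_continuous_for oU fg Uz (cf z Uz)).
- by move=> z Uz; have [d1 d2] := df z Uz; split; exact: is_rder_derivable (D _ _ Uz _).
- apply: IH c1 => z; rewrite inE => Uz; apply/esym; apply: is_rderE (D _ _ Uz _).
  by case: (df z Uz).
- apply: IH c2 => z; rewrite inE => Uz; apply/esym; apply: is_rderE (D _ _ Uz _).
  by case: (df z Uz).
Qed.

Lemma continuous_lin (a : C) f g z : {for z, continuous f} -> {for z, continuous g} ->
  {for z, continuous (fun z => a * f z + g z)}.
Proof. by move=> cf cg; exact: (cvgD (cvgM (cvg_cst a) cf) cg). Qed.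

Lemma Ck_lin k U (a : C) f g : open U -> Ck k U f -> Ck k U g ->
  Ck k U (fun z => a * f z + g z).
Proof.
move=> oU; elim: k f g => [|k IH] f g.
  by move=> cf cg z Uz; exact: (continuous_lin (cf z Uz) (cg z Uz)).
move=> [cf df f1 f2] [cg dg g1 g2].
have D d z : rderivable f d z -> rderivable g d z ->
    is_rder (fun z => a * f z + g z) d z (a * rder f d z + rder g d z).
  by move=> /is_rderP dfz /is_rderP dgz; exact: is_rder_lin.
split.
- by move=> z Uz; exact: (continuous_lin (cf z Uz) (cg z Uz)).
- move=> z Uz; have [df1 df2] := df z Uz; have [dg1 dg2] := dg z Uz.
  by split; apply: is_rder_derivable; apply: D.
- apply: eq_Ck (IH _ _ f1 g1) => // z; rewrite inE => Uz.
  have [df1 df2] := df z Uz; have [dg1 dg2] := dg z Uz.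
  by apply/esym; apply: is_rderE (D _ _ _ _).
- apply: eq_Ck (IH _ _ f2 g2) => // z; rewrite inE => Uz.
  have [df1 df2] := df z Uz; have [dg1 dg2] := dg z Uz.
  by apply/esym; apply: is_rderE (D _ _ _ _).
Qed.

Lemma smooth_lin U (a : C) f g : open U -> smooth U f -> smooth U g ->
  smooth U (fun z => a * f z + g z).
Proof. by move=> oU sf sg k; apply: Ck_lin. Qed.

Lemma smooth_rderivable U f z : smooth U f -> U z ->
  rderivable f 1 z /\ rderivable f (iC R) z.
Proof. by move=> /(_ 1%N) [_ H _ _]; exact: H. Qed.

Lemma d_zbar_lin (a : C) f g z :
  rderivable f 1 z /\ rderivable f (iC R) z ->
  rderivable g 1 z /\ rderivable g (iC R) z ->
  d_zbar (fun z => a * f z + g z) z = a * d_zbar f z + d_zbar g z.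
Proof.
move=> [f1 f2] [g1 g2]; rewrite /d_zbar.
rewrite (is_rderE (is_rder_lin a (is_rderP f1) (is_rderP g1))).
rewrite (is_rderE (is_rder_lin a (is_rderP f2) (is_rderP g2))).
ring.
Qed.

Lemma is_rder_cst (a d z : C) : is_rder (fun=> a) d z 0.
Proof.
by split; [exact: (is_derive_cst (reC a) (0 : R) (1 : R))
          |exact: (is_derive_cst (imC a) (0 : R) (1 : R))].
Qed.

Lemma rderivable_cst (a z : C) :
  rderivable (fun=> a) 1 z /\ rderivable (fun=> a) (iC R) z.
Proof. by split; apply: is_rder_derivable (is_rder_cst _ _ _). Qed.

Lemma rder_cst (a d z : C) : rder (fun=> a) d z = 0.
Proof. exact: is_rderE (is_rder_cst _ _ _). Qed.

Lemma d_zbar_cst (a z : C) : d_zbar (fun=> a) z = 0.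
Proof. by rewrite /d_zbar !rder_cst mulr0 addr0 mul0r. Qed.

Lemma d_z_cst (a z : C) : d_z (fun=> a) z = 0.
Proof. by rewrite /d_z !rder_cst mulr0 subr0 mul0r. Qed.

Lemma d_zbarZ (a : C) f z : rderivable f 1 z /\ rderivable f (iC R) z ->
  d_zbar (fun z => a * f z) z = a * d_zbar f z.
Proof.
move=> df; have -> : (fun z => a * f z) = (fun z => a * f z + 0).
  by apply/funext => w; rewrite [RHS]addr0.
by rewrite (d_zbar_lin a df (rderivable_cst 0 z)) d_zbar_cst [LHS]addr0.
Qed.

Lemma d_z_lin (a : C) f g z :
  rderivable f 1 z /\ rderivable f (iC R) z ->
  rderivable g 1 z /\ rderivable g (iC R) z ->
  d_z (fun z => a * f z + g z) z = a * d_z f z + d_z g z.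
Proof.
move=> [f1 f2] [g1 g2]; rewrite /d_z.
rewrite (is_rderE (is_rder_lin a (is_rderP f1) (is_rderP g1))).
rewrite (is_rderE (is_rder_lin a (is_rderP f2) (is_rderP g2))).
ring.
Qed.

Definition smexpC f := exists f1 f2 : R -> R -> R, [/\ smexp f1, smexp f2
  & forall z, f z = mkC (f1 (reC z) (imC z)) (f2 (reC z) (imC z))].

Lemma is_rder1 (f1 f2 g1 g2 : R -> R -> R) f z :
  (forall z, f z = mkC (f1 (reC z) (imC z)) (f2 (reC z) (imC z))) ->
  (forall x y : R, is_derive x (1 : R) (f1^~ y) (g1 x y)) ->
  (forall x y : R, is_derive x (1 : R) (f2^~ y) (g2 x y)) ->
  is_rder f 1 z (mkC (g1 (reC z) (imC z)) (g2 (reC z) (imC z))).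
Proof.
move=> fE d1 d2.
have dt (x : R) : is_derive (0 : R) (1 : R) (fun t : R => x + t) 1.
  by refine (is_derive_eq (is_deriveD (is_derive_cst x (0 : R) (1 : R)) (is_derive_id
    (0 : R) (1 : R))) _); rewrite add0r.
have E t : z + toC t * 1 = mkC (reC z + t) (imC z).
  by rewrite mulr1; apply: eqC; rewrite ?reCD ?imCD //= addr0.
split => /=.
- have := d1 (reC z + 0) (imC z) => /(fun h => is_derive1_comp h (dt (reC z))).
  rewrite addr0 mulr1; congr (is_derive _ _ _ _).
  by apply/funext => t; rewrite /= /rline E fE.
- have := d2 (reC z + 0) (imC z) => /(fun h => is_derive1_comp h (dt (reC z))).
  rewrite addr0 mulr1; congr (is_derive _ _ _ _).
  by apply/funext => t; rewrite /= /rline E fE.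
Qed.

Lemma is_rder_i (f1 f2 g1 g2 : R -> R -> R) f z :
  (forall z, f z = mkC (f1 (reC z) (imC z)) (f2 (reC z) (imC z))) ->
  (forall x y : R, is_derive y (1 : R) (f1 x) (g1 x y)) ->
  (forall x y : R, is_derive y (1 : R) (f2 x) (g2 x y)) ->
  is_rder f (iC R) z (mkC (g1 (reC z) (imC z)) (g2 (reC z) (imC z))).
Proof.
move=> fE d1 d2.
have dt (x : R) : is_derive (0 : R) (1 : R) (fun t : R => x + t) 1.
  by refine (is_derive_eq (is_deriveD (is_derive_cst x (0 : R) (1 : R)) (is_derive_id
    (0 : R) (1 : R))) _); rewrite add0r.
have E t : z + toC t * iC R = mkC (reC z) (imC z + t).
  by apply: eqC; rewrite ?reCD ?imCD ?reCM ?imCM /=; ring.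
split => /=.
- have := d1 (reC z) (imC z + 0) => /(fun h => is_derive1_comp h (dt (imC z))).
  rewrite addr0 mulr1; congr (is_derive _ _ _ _).
  by apply/funext => t; rewrite /= /rline E fE.
- have := d2 (reC z) (imC z + 0) => /(fun h => is_derive1_comp h (dt (imC z))).
  rewrite addr0 mulr1; congr (is_derive _ _ _ _).
  by apply/funext => t; rewrite /= /rline E fE.
Qed.

Lemma smexpC_continuous f z : smexpC f -> {for z, continuous f}.
Proof.
move=> [f1 [f2 [s1 s2 fE]]].
have -> : f = fun z => mkC (f1 (reC z) (imC z)) (f2 (reC z) (imC z)) by apply/funext.
have c : (reC w, imC w) @[w --> z] --> (reC z, imC z).
  exact: (cvg_pair (@continuous_reC R z) (@continuous_imC R z)).
have H (h : R -> R -> R) : smexp h ->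
    h (reC w) (imC w) @[w --> z] --> h (reC z) (imC z).
  by move=> sh; exact: (@cvg_comp _ _ _ _ (fun u => h u.1 u.2) _ _ _ c
    (@smexp_continuous _ _ sh (reC z, imC z))).
exact: (cvg_mkC (H _ s1) (H _ s2)).
Qed.

(** The algebra is closed under both partial derivatives, so the induction on the order never leaves
    it. *)
Lemma smexpC_smooth U f : smexpC f -> smooth U f.
Proof.
move=> sf k; elim: k f sf => [|k IH] f sf.
  by move=> z _; exact: smexpC_continuous.
have [f1 [f2 [s1 s2 fE]]] := sf.
have [g1 sg1 d1] := smexp_dx s1; have [g2 sg2 d2] := smexp_dx s2.
have [h1 sh1 e1] := smexp_dy s1; have [h2 sh2 e2] := smexp_dy s2.
split.
- by move=> z _; exact: smexpC_continuous.
- move=> z _; split; apply: is_rder_derivable.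
    exact: is_rder1 fE d1 d2.
  exact: is_rder_i fE e1 e2.
- apply: IH; exists g1, g2; split => // z; exact/is_rderE/(is_rder1 _ fE d1 d2).
- apply: IH; exists h1, h2; split => // z; exact/is_rderE/(is_rder_i _ fE e1 e2).
Qed.

End RealDerivatives.

(** * Integrals over plane sets *)

Section PlaneIntegrals.
Variable R : realType.
Local Notation C := (Cx R).
Local Notation mu := (@lebesgue_measure R).
Local Notation mu2 := (mu \x mu)%E.
Local Notation RR := (measurableTypeR R * measurableTypeR R)%type.
Implicit Types (A B : set C) (f g : C -> C) (v w : C).

Definition plane A : set RR := [set u | A (mkC u.1 u.2)].

Definition measC A := measurable (plane A).

Lemma continuous_mkC : continuous (fun u : R * R => mkC u.1 u.2 : C).
Proof. by move=> u; apply: cvg_mkC; [exact: cvg_fst|exact: cvg_snd]. Qed.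

(** The sigma-algebra is that of the product, so O is exhibited as the countable union of the open
    squares with rational centre and radius that it contains. *)
Lemma open_measurable_plane (O : set (R * R)) : open O -> measurable (O : set RR).
Proof.
move=> oO.
pose P (q1 q2 e : rat) : set RR :=
  [set u | (forall x y : R, `|ratr q1 - x| < ratr e -> `|ratr q2 - y| < ratr e -> O (x,
    y)) /\
    (`|ratr q1 - u.1| < ratr e /\ `|ratr q2 - u.2| < ratr e)].
rewrite (_ : (O : set RR) = \bigcup_(q1 : rat) \bigcup_(q2 : rat) \bigcup_(e : rat) P
  q1 q2 e).
  apply: bigcupT_measurable_rat => q1; apply: bigcupT_measurable_rat => q2.
  apply: bigcupT_measurable_rat => e.
  have [H|nH] := pselect (forall x y : R, `|ratr q1 - x| < ratr e ->
      `|ratr q2 - y| < ratr e -> O (x, y)); last first.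
    by rewrite (_ : P _ _ _ = set0) ?measurable0//; apply/seteqP; split => // u [].
  rewrite (_ : P _ _ _ = ball (ratr q1 : R) (ratr e) `*` ball (ratr q2 : R) (ratr e)).
    by apply: measurableX; exact: measurable_ball.
  by apply/seteqP; split => u [] //= ? ?; split.
apply/seteqP; split => [[x y] Oxy|u [q1 _ [q2 _ [e _ [H [u1 u2]]]]]]; last first.
  by rewrite (surjective_pairing u); exact: H.
have /nbhs_ballP[e /= e0 He] : nbhs (x, y) O by exact: open_nbhs_nbhs.
(* A radius below e / 2 guarantees that a square containing (x, y) stays inside the ball of radius e
   around it. *)
have [d /andP[d0 de]] : exists d : rat, 0 < (ratr d : R) < e / 2.
  have [d] := @rat_in_itvoo _ 0 (e / 2) (divr_gt0 e0 (ltr0Sn _ _)).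
  by rewrite in_itv /=; exists d.
have [q1] := @rat_in_itvoo _ (x - ratr d) (x + ratr d) ltac:(lra).
rewrite in_itv /= => /andP[q11 q12].
have [q2] := @rat_in_itvoo _ (y - ratr d) (y + ratr d) ltac:(lra).
rewrite in_itv /= => /andP[q21 q22].
exists q1 => //; exists q2 => //; exists d => //; split => [x' y' h1 h2|]; last first.
  by split; rewrite ltr_norml /=; apply/andP; split; lra.
apply: He; split; rewrite /ball /= ltr_norml; apply/andP;
  move: h1 h2; rewrite !ltr_norml => /andP[? ?] /andP[? ?]; split; lra.
Qed.

Lemma open_measC A : open A -> measC A.
Proof.
move=> oA; apply: open_measurable_plane.
by move/continuousP : continuous_mkC; apply.
Qed.

Lemma has_integral_lin A (a : C) f g v w : measC A ->
  has_integral A f v -> has_integral A g w ->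
  has_integral A (fun z => a * f z + g z) (a * v + w).
Proof.
move=> mA [fr fi ->] [gr gi ->].
have L (k1 k2 : R) (h1 h2 h3 : RR -> R) : mu2.-integrable (plane A) (EFin \o h1) ->
    mu2.-integrable (plane A) (EFin \o h2) -> mu2.-integrable (plane A) (EFin \o h3) ->
    mu2.-integrable (plane A) (EFin \o (fun u => k1 * h1 u + k2 * h2 u + h3 u)) /\
    Rintegral mu2 (plane A) (fun u => k1 * h1 u + k2 * h2 u + h3 u) =
    k1 * Rintegral mu2 (plane A) h1 + k2 * Rintegral mu2 (plane A) h2
      + Rintegral mu2 (plane A) h3.
  move=> i1 i2 i3.
  have j1 : mu2.-integrable (plane A) (EFin \o (fun u => k1 * h1 u)).
    exact: (integrableZl mA _ i1).
  have j2 : mu2.-integrable (plane A) (EFin \o (fun u => k2 * h2 u)).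
    exact: (integrableZl mA _ i2).
  have j12 : mu2.-integrable (plane A) (EFin \o (fun u => k1 * h1 u + k2 * h2 u)).
    exact: (integrableD mA j1 j2).
  split; first exact: (integrableD mA j12 i3).
  by rewrite (RintegralD mA j12 i3) (RintegralD mA j1 j2) (RintegralZl _ mA i1)
    (RintegralZl _ mA i2).
have [i1 e1] := L (reC a) (- imC a) _ _ _ fr fi gr.
have [i2 e2] := L (reC a) (imC a) _ _ _ fi fr gi.
have E1 : (fun u : RR => reC (a * f (mkC u.1 u.2) + g (mkC u.1 u.2))) =
  (fun u => reC a * reC (f (mkC u.1 u.2)) + - imC a * imC (f (mkC u.1 u.2))
     + reC (g (mkC u.1 u.2))).
  by apply/funext => u; rewrite reCD reCM mulNr.
have E2 : (fun u : RR => imC (a * f (mkC u.1 u.2) + g (mkC u.1 u.2))) =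
  (fun u => reC a * imC (f (mkC u.1 u.2)) + imC a * reC (f (mkC u.1 u.2))
     + imC (g (mkC u.1 u.2))).
  by apply/funext => u; rewrite imCD imCM.
split; rewrite ?E1 ?E2 //.
apply: eqC.
  by rewrite reCD reCM /= -mulNr -e1.
by rewrite imCD imCM /= -e2.
Qed.

Lemma eq_has_integral A f g v : measC A -> (forall z, A z -> f z = g z) ->
  has_integral A f v -> has_integral A g v.
Proof.
move=> mA fg [fr fi ->].
have E (h : C -> R) (u : RR) : u \in plane A -> h (f (mkC u.1 u.2)) = h (g (mkC u.1
  u.2)).
  by rewrite inE => Au; rewrite fg.
split.
- by apply: (eq_integrable mA _ _ _ fr) => u uA /=; rewrite (E (@reC R) _ uA).
- by apply: (eq_integrable mA _ _ _ fi) => u uA /=; rewrite (E (@imC R) _ uA).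
- by apply: eqC => /=; apply: eq_Rintegral => u uA; rewrite (E _ _ uA).
Qed.

Lemma has_integral0 A : has_integral A (fun=> 0) 0.
Proof.
have i0 : mu2.-integrable (plane A) (EFin \o (fun=> 0)).
  exact: integrable0.
by split => //; apply: eqC; rewrite /= /Rintegral integral0.
Qed.

Lemma has_integral_sum (I : Type) (s : seq I) A (F : I -> C -> C) (a v : I -> C) :
  measC A -> (forall i, has_integral A (F i) (v i)) ->
  has_integral A (fun z => \sum_(i <- s) a i * F i z) (\sum_(i <- s) a i * v i).
Proof.
move=> mA FE; elim: s => [|i s IH].
  rewrite big_nil; apply: (eq_has_integral mA _ (has_integral0 A)) => z _.
  by rewrite big_nil.
rewrite big_cons; apply: (eq_has_integral mA _ (has_integral_lin (a i) mA (FE i) IH)).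
by move=> z _; rewrite big_cons.
Qed.

Lemma has_integral_dominated A (F : nat -> C -> C) f (V : nat -> C) v (M : R) :
  measC A -> (mu2 (plane A) < +oo)%E ->
  (forall n, has_integral A (F n) (V n)) ->
  (forall z, A z -> F n z @[n --> \oo] --> f z) ->
  (forall n z, A z -> modC (F n z) <= M) ->
  V n @[n --> \oo] --> v ->
  has_integral A f v.
Proof.
move=> mA fA FV Ff FM Vv.
have iM : mu2.-integrable (plane A) (EFin \o (fun=> M)).
  apply: measurable_bounded_integrable => //; exists `|M|; split => [|N MN u _] /=.
    exact: num_real.
  exact: ltW.
have L (H : RR -> R) (h : nat -> RR -> R) (l : R) :
    (forall n, mu2.-integrable (plane A) (EFin \o h n)) ->
    (forall u, plane A u -> h n u @[n --> \oo] --> H u) ->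
    (forall n u, plane A u -> `|h n u| <= M) ->
    Rintegral mu2 (plane A) (h n) @[n --> \oo] --> l ->
    mu2.-integrable (plane A) (EFin \o H) /\ Rintegral mu2 (plane A) H = l.
  move=> ih hH hM hl.
  have mh n : measurable_fun (plane A) (EFin \o h n) by have /integrableP[] := ih n.
  have hH' u : plane A u -> (EFin \o h n) u @[n --> \oo] --> (EFin \o H) u.
    by move=> Au; apply: cvg_EFin; [exact: nearW|exact: hH].
  have mH : measurable_fun (plane A) (EFin \o H).
    exact: (emeasurable_fun_cvg _ _ mh hH').
  have ae1 : {ae mu2, forall u, plane A u -> (EFin \o h n) u @[n --> \oo] --> (EFin \o
    H) u}.
    exact: aeW.
  have ae2 : {ae mu2, forall u n, plane A u -> (`|(EFin \o h n) u| <= (EFin \o (fun=>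
    M)) u)%E}.
    by apply: aeW => u n Au; rewrite lee_fin hM.
  have [iH _ cH] := dominated_convergence mA mh mH ae1 iM ae2.
  split => //.
  have cR : Rintegral mu2 (plane A) (h n) @[n --> \oo] --> Rintegral mu2 (plane A) H.
    by apply: fine_cvg; rewrite fineK//; exact: integrable_fin_num.
  exact: (cvg_unique _ cR hl).
have cre : (fun n => reC (V n)) n @[n --> \oo] --> reC v.
  exact: (@cvg_comp _ _ _ _ (@reC R) _ _ _ Vv (@continuous_reC R v)).
have cim : (fun n => imC (V n)) n @[n --> \oo] --> imC v.
  exact: (@cvg_comp _ _ _ _ (@imC R) _ _ _ Vv (@continuous_imC R v)).
have [|||| i1 e1] := L (fun u => reC (f (mkC u.1 u.2))) (fun n u => reC (F n (mkC u.1
  u.2))) (reC v).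
- by move=> n; have [] := FV n.
- move=> u Au.
  exact: (@cvg_comp _ _ _ _ (@reC R) _ _ _ (Ff _ Au) (@continuous_reC R _)).
- by move=> n u Au; rewrite (le_trans (le_reC _))// FM.
- by apply: cvg_trans cre; apply: near_eq_cvg; apply: nearW => n; have [_ _ ->] := FV n.
have [|||| i2 e2] := L (fun u => imC (f (mkC u.1 u.2))) (fun n u => imC (F n (mkC u.1
  u.2))) (imC v).
- by move=> n; have [] := FV n.
- move=> u Au.
  exact: (@cvg_comp _ _ _ _ (@imC R) _ _ _ (Ff _ Au) (@continuous_imC R _)).
- by move=> n u Au; rewrite (le_trans (le_imC _))// FM.
- by apply: cvg_trans cim; apply: near_eq_cvg; apply: nearW => n; have [_ _ ->] := FV n.
by split => //; apply: eqC.
Qed.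

End PlaneIntegrals.

(** * Laurent expansions on an annulus *)

Section Annulus.
Variable R : realType.
Local Notation C := (Cx R).
Local Notation mu := (@lebesgue_measure R).
Local Notation mu2 := (mu \x mu)%E.
Local Notation I := (`[(-1 : R), 1]%classic).
Local Notation Q := (I `*` I).
Local Notation RR := (measurableTypeR R * measurableTypeR R)%type.
Variables u1 u2 : R.
Hypotheses (u1_gt0 : 0 < u1) (u1u2 : u1 < u2) (u2_le1 : u2 <= 1).
Implicit Types z : C.

Definition annulus : set C := [set z | u1 <= modC z ^+ 2 <= u2].

Lemma annulus_square (u : RR) : plane annulus u -> (Q : set RR) u.
Proof.
rewrite /plane /annulus /= sqr_modC /= => /andP[_ Nu].
have {Nu}Nu := le_trans Nu u2_le1.
by split; rewrite /= in_itv /= -ler_norml -(@ler_pXn2r _ 2) ?nnegrE// expr1n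
  real_normK ?num_real// (le_trans _ Nu)// ?lerDl ?lerDr sqr_ge0.
Qed.

Lemma annulus_meas : measC annulus.
Proof.
have mN := smexp_measurable (radial_smexp (radial_norm2 R)).
have := mN measurableT _ (measurable_itv `[u1, u2]); rewrite setTI.
congr measurable; apply/seteqP; split => u;
  by rewrite /plane /annulus /= sqr_modC /= in_itv.
Qed.

Lemma annulus_finite : (mu2 (plane annulus) < +oo)%E.
Proof.
have mQ := @measurable_square R.
apply: (@le_lt_trans _ _ (mu2 Q)).
  by apply: le_measure; rewrite ?inE//; [exact: annulus_meas|exact: annulus_square].
have : (mu2 Q = mu I * mu I)%E by apply: product_measure1E; exact: measurable_itv.
by move=> /= ->; rewrite lebesgue_measure_itv /= lte_fin; case: ifP;
  rewrite -?EFinM ltry.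
Qed.

(** The integrand vanishes on the square outside the annulus, so the integral over the square is
    inherited. *)
Lemma has_integral_zmon p q :
  has_integral annulus (fun z => zmon u1 u2 p q (reC z) (imC z))
    (toC (- (p == q)%:R * pi)).
Proof.
have mQ := @measurable_square R; have mA := annulus_meas.
have [sr si] := smexp_zmon u2 u1_gt0 p q.
have [er ei] := Rintegral_zmon u1_gt0 u1u2 u2_le1 p q.
have L (h : C -> R) : h 0 = 0 ->
    Rintegral mu2 (plane annulus) (fun u => h (zmon u1 u2 p q u.1 u.2)) =
    Rintegral mu2 Q (fun u => h (zmon u1 u2 p q u.1 u.2)).
  move=> h0; have -> : plane annulus = Q `&` plane annulus.
    by rewrite setIidr//; exact: annulus_square.
  rewrite Rintegral_mkcondr; apply: eq_Rintegral => u _.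
  rewrite patchE; case: ifPn => // /negP nA; rewrite zmon0 ?h0// => H.
  by apply: nA; rewrite inE /plane /annulus /= sqr_modC.
split.
- exact: (smexp_integrable mA annulus_square sr).
- exact: (smexp_integrable mA annulus_square si).
- by apply: eqC => /=; [rewrite -er -L|rewrite -ei -L].
Qed.

Lemma zmonE p q z : annulus z -> zmon u1 u2 p q (reC z) (imC z) =
  z ^+ p * z^-1 ^+ q * toC (dcutoff u1 u2 (modC z ^+ 2)).
Proof.
move=> /andP[Nz _]; rewrite /zmon mkC_eta invNE -?sqr_modC//.
rewrite toCM toCX toCV -mulC_conj mulrA; congr (_ * _).
rewrite -mulrA -exprMn; congr (_ * _ ^+ _); have z0 : z != 0.
  by rewrite -modC_eq0 -sqrf_eq0 gt_eqF// (lt_le_trans u1_gt0).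
have zc : conjC z != 0.
  apply/eqP => H; move: (mulC_conj z); rewrite H mulr0 => /esym/eqP.
  by rewrite toC_eq0 sqrf_eq0 modC_eq0 (negPf z0).
by field; rewrite z0.
Qed.

(** Dominated convergence on the square partial sums: they are bounded by M, and [dcutoff] is
    bounded on the unit square. Only diagonal terms survive, each with weight -pi; the division by 4
    undoes the normalization of [Laur]. *)
Lemma annulus_integral (t : C) (coef : nat -> nat -> C) (f : C -> C) (M : R) (L : C) :
  (forall z, annulus z -> (fun n => \sum_(p < n) \sum_(q < n)
     coef p q * z ^+ p * (t / z) ^+ q) n @[n --> \oo] --> f z) ->
  (forall z n, annulus z -> \sum_(p < n) \sum_(q < n)
     modC (coef p q * z ^+ p * (t / z) ^+ q) <= M) ->
  (fun n => 4%:R * \sum_(p < n) coef p p * t ^+ p) n @[n --> \oo] --> L ->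
  has_integral annulus (fun z => toC (dcutoff u1 u2 (modC z ^+ 2)) * f z)
    (- toC pi / 4%:R * L).
Proof.
move=> cf bf cL; have mA := annulus_meas.
have [M' HM'] := smexp_bounded (smexp_dcutoff u1 u2).
(* The factor 1 gives the outer sum the shape required by [has_integral_sum], which is applied once
   per index. *)
have FE n z : annulus z ->
    \sum_(p < n) 1 * (\sum_(q < n) (coef p q * t ^+ q) * zmon u1 u2 p q (reC z) (imC
      z)) =
    toC (dcutoff u1 u2 (modC z ^+ 2)) * \sum_(p < n) \sum_(q < n)
      coef p q * z ^+ p * (t / z) ^+ q.
  move=> Az; rewrite mulr_sumr; apply: eq_bigr => p _; rewrite mul1r mulr_sumr.
  by apply: eq_bigr => q _; rewrite zmonE// exprMn; ring.
apply: (has_integral_dominated mA annulus_finite (M := M' * M)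
  (F := fun n z => \sum_(p < n) 1 * (\sum_(q < n) (coef p q * t ^+ q) * zmon u1 u2 p q
    (reC z) (imC z)))
  (V := fun n => \sum_(p < n) 1 * (\sum_(q < n) (coef p q * t ^+ q) * toC (- (p == q :>
    nat)%:R * pi)))).
- move=> n; apply: (has_integral_sum _ (fun=> 1)) => // p.
  by apply: (has_integral_sum _ (fun q : 'I_n => coef p q * t ^+ q)) => // q;
    exact: has_integral_zmon.
- move=> z Az; under eq_fun do rewrite FE//.
  by apply: cvgM; [exact: cvg_cst|exact: cf].
- move=> n z Az; rewrite FE// modCM.
  have [Q1 Q2] : (Q : set RR) (reC z, imC z).
    by apply: annulus_square; rewrite /plane /= mkC_eta.
  apply: ler_pM; rewrite ?modC_ge0//.
    by rewrite /modC /= expr0n addr0 sqrtr_sqr -/(modC z) sqr_modC; exact: HM'.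
  rewrite (le_trans (le_modC_sum _ _))// (le_trans _ (bf z n Az))//.
  by apply: ler_sum => p _; exact: le_modC_sum.
- have VE n : \sum_(p < n) 1 * (\sum_(q < n) (coef p q * t ^+ q) * toC (- (p == q :>
    nat)%:R * pi)) =
      - toC pi / 4%:R * (4%:R * \sum_(p < n) coef p p * t ^+ p).
    rewrite !mulr_sumr; apply: eq_bigr => p _.
    rewrite mul1r (bigD1 p)//= big1 ?addr0 => [|q qp].
      rewrite eqxx (_ : toC _ = - toC pi); first by field.
      by apply: eqC; rewrite ?reCN ?imCN /=; ring.
    rewrite (_ : (p == q :> nat) = false); first by rewrite oppr0 mul0r mulr0.
    by apply/negbTE; rewrite eq_sym.
  under eq_fun do rewrite VE.
  by apply: cvgM; [exact: cvg_cst|exact: cL].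
Qed.

End Annulus.

(** * Open sets of the surface *)

Section Openness.
Variable R : realType.
Local Notation C := (Cx R).

(** The disc is the continuous image of a closed part of a compact real square. *)
Lemma compact_disc (d : R) : compact [set z : C | `|z| <= toC d].
Proof.
have [d0|d0] := ltP d 0.
  rewrite (_ : [set _ | _] = set0); first exact: compact0.
  apply/seteqP; split => // z /=; rewrite normCE leC_toC => /(le_trans (modC_ge0 z)).
  by rewrite leNgt d0.
have cI : compact (`[- d, d]%classic `*` `[- d, d]%classic : set (R * R)).
  by apply: compact_setX; exact: segment_compact.
rewrite (_ : [set _ | _] = (fun u : R * R => mkC u.1 u.2 : C) @`
    [set u : R * R | u.1 ^+ 2 + u.2 ^+ 2 <= d ^+ 2]); last first.
  apply/seteqP; split => [z|_ [u /= Hu <-]] /=.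
    rewrite normCE leC_toC => zd; exists (reC z, imC z) => /=; last exact: mkC_eta.
    by rewrite -sqr_modC ler_pXn2r ?nnegrE ?modC_ge0.
  by rewrite normCE leC_toC -(@ler_pXn2r _ 2) ?nnegrE ?modC_ge0// sqr_modC.
apply: continuous_compact.
  by apply: continuous_subspaceT; exact: continuous_mkC.
apply: (subclosed_compact _ cI).
  rewrite (_ : [set _ | _] = (fun u : R * R => u.1 ^+ 2 + u.2 ^+ 2) @^-1` [set x | x <=
    d ^+ 2])//.
  apply: closed_comp; last exact: closed_le.
  by move=> u _; exact: (smexp_continuous (radial_smexp (radial_norm2 R))).
move=> u /= Nu.
split; rewrite /= in_itv /= -ler_norml -(@ler_pXn2r _ 2) ?nnegrE//
  real_normK ?num_real// (le_trans _ Nu)// ?lerDl ?lerDr sqr_ge0//.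
Qed.

Lemma open_chart_part (X : compact_riemann_surface R) (c : chart R X) (A : set X) :
  is_chart c -> open A -> open (chart_part c A).
Proof.
move=> [_ oI _ _ ci] oA; rewrite openE => z [Iz Az]; apply: filterI.
  exact: open_nbhs_nbhs.
by apply: (ci z Iz); exact: open_nbhs_nbhs.
Qed.

(** The set is the image of a compact disc under [ch_inv]; as the surface is Hausdorff, it is closed
    in the surface and not merely in the chart domain. *)
Lemma closed_disc_dom (X : compact_riemann_surface R) (c : chart R X) (d : R) :
  is_chart c -> (forall z : C, `|z| <= toC d -> ch_im c z) ->
  closed [set p | ch_dom c p /\ `|c p| <= toC d].
Proof.
move=> [_ oI cK _ ci] dI.
rewrite (_ : [set _ | _] = ch_inv c @` [set z : C | `|z| <= toC d]); last first.
  apply/seteqP; split => [p [dp cp]|_ [z /= zd <-]] /=.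
    by exists (c p) => //; exact: cK.
  have [q dq qz] := dI _ zd; rewrite -qz cK//; split => //.
  by rewrite -qz in zd.
apply: compact_closed; first exact: rs_hausdorff.
apply: continuous_compact; last exact: compact_disc.
by apply: continuous_in_subspaceT => z; rewrite inE => zd; apply: ci; exact: dI.
Qed.

Lemma open_bulk n m (F : st_family R n m) : open (@bulk R n m F).
Proof.
have c0 := fam_c_gt0 F; have c1 := fam_c_lt1 F.
have cc : toC (fam_c F ^+ 2) < toC (fam_c F).
  by rewrite ltC_toC expr2 gtr_pMr.
rewrite openE => p bp; apply: filter_forall => k; have [bz bw] := bp k.
have [[cz _] _ _] := fam_zP F k; have [[cw _] _ _] := fam_wP F k.
apply: filterI.
- have := closed_disc_dom cz (fun z zc => fam_c_z k (le_lt_trans zc cc)).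
  by move=> /closed_openC oz; exact: (open_nbhs_nbhs (conj oz bz)).
- have := closed_disc_dom cw (fun z zc => fam_c_w k (le_lt_trans zc cc)).
  by move=> /closed_openC ow; exact: (open_nbhs_nbhs (conj ow bw)).
Qed.

Lemma open_collar n m (F : st_family R n m) b k : open (collar F b k).
Proof.
rewrite openE => z [z0 zc tc].
have cV : {for z, continuous (fun w : C => t_ b k / w)}.
  by apply: (@cvgM _ _ (nbhs z)); [exact: cvg_cst|apply: cvgV;
    [exact: z0|exact: cvg_id]].
have n1 : \forall w \near z, w != 0.
  exact: (@cvgr_neq0 _ _ _ (nbhs z) _ _ z cvg_id z0).
have n2 : \forall w \near z, `|w| < toC (fam_c F).
  exact: (@cvgr_norm_lt _ _ _ (nbhs z) _ _ z cvg_id _ zc).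
have n3 : \forall w \near z, `|t_ b k / w| < toC (fam_c F).
  exact: (cvgr_norm_lt _ cV _ tc).
near=> w; split; near: w; [exact: n1|exact: n2|exact: n3].
Unshelve. all: by end_near. Qed.

Lemma rs_atlas_holo (X : compact_riemann_surface R) (i : 'I_(@rs_size R X)) :
  holo_chart (rs_atlas i).
Proof. by split; [exact: rs_atlasP|move=> j; split; exact: rs_compat]. Qed.

Lemma measC_cell (X : compact_riemann_surface R) (i : 'I_(@rs_size R X)) (A : set X) :
  open A -> measC (chart_part (rs_atlas i) (cell i `&` A)).
Proof.
move=> oA; have [cI _] := rs_atlas_holo i; have od j : open (ch_dom (@rs_atlas R X j)).
  by have [[]] := rs_atlas_holo j.
rewrite /measC (_ : plane _ = plane (chart_part (rs_atlas i) (ch_dom (rs_atlas i) `&`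
  A)) `\`
  \bigcup_(j in [set j : 'I_(@rs_size R X) | (j < i)%N])
     plane (chart_part (rs_atlas i) (ch_dom (rs_atlas j)))).
  apply: measurableD.
    by apply: open_measC; apply: open_chart_part => //; exact: openI.
  apply: fin_bigcup_measurable => [|j _]; first exact: finite_finset.
  by apply: open_measC; exact: open_chart_part.
apply/seteqP; split => u.
  move=> [/= Iu [[du ndu] Au]]; split => // -[j /= ji [_ dj]]; exact: ndu dj.
move=> [/= [Iu [du Au]] nd]; split => //; split => //; split => // j ji dj.
by apply: nd; exists j.
Qed.

End Openness.

(** * The pairing *)

Section CutoffField.
Variable R : realType.
Local Notation C := (Cx R).
Variables u1 u2 : R.

Definition cutfield (z : C) : C := z * toC (cutoff u1 u2 (modC z ^+ 2)).

Local Notation N x y := (x ^+ 2 + y ^+ 2).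

Let cutfieldE z : cutfield z =
  mkC (reC z * cutoff u1 u2 (N (reC z) (imC z))) (imC z * cutoff u1 u2 (N (reC z) (imC
    z))).
Proof. by rewrite /cutfield sqr_modC; apply: eqC; rewrite ?reCM ?imCM /=; ring. Qed.

Lemma smexpC_cutfield : smexpC cutfield.
Proof.
exists (fun x y => x * cutoff u1 u2 (N x y)), (fun x y => y * cutoff u1 u2 (N x y)).
split; last exact: cutfieldE.
  by apply: smexpM; [exact: smexp_x|exact: smexp_cutoff].
by apply: smexpM; [exact: smexp_y|exact: smexp_cutoff].
Qed.

(** The factor z is holomorphic and the zbar-derivative of |z|^2 is z, whence z^2. *)
Lemma d_zbar_cutfield z :
  d_zbar cutfield z = z ^+ 2 * toC (dcutoff u1 u2 (modC z ^+ 2)).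
Proof.
have dc (x y : R) : is_derive x (1 : R) (fun x => cutoff u1 u2 (N x y)) (dcutoff u1 u2
  (N x y) * (2 * x)).
  exact: (is_derive_cutoff u1 u2 (is_derive_N x y)).
have dc' (x y : R) : is_derive y (1 : R) (fun y => cutoff u1 u2 (N x y)) (dcutoff u1 u2
  (N x y) * (2 * y)).
  have -> : (fun y => cutoff u1 u2 (N x y)) = (fun y => cutoff u1 u2 (N y x)).
    by apply/funext => w; rewrite addrC.
  by rewrite addrC; exact: dc.
have d1 (x y : R) : is_derive x (1 : R) (fun x => x * cutoff u1 u2 (N x y))
    (cutoff u1 u2 (N x y) + x * (dcutoff u1 u2 (N x y) * (2 * x))).
  refine (is_derive_eq (is_deriveM (is_derive_id x (1 : R)) (dc x y)) _).
  by rewrite /GRing.scale /=; ring.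
have d2 (x y : R) : is_derive x (1 : R) (fun x => y * cutoff u1 u2 (N x y))
    (y * (dcutoff u1 u2 (N x y) * (2 * x))).
  exact: (is_deriveZ y (dc x y)).
have e1 (x y : R) : is_derive y (1 : R) (fun y => x * cutoff u1 u2 (N x y))
    (x * (dcutoff u1 u2 (N x y) * (2 * y))).
  exact: (is_deriveZ x (dc' x y)).
have e2 (x y : R) : is_derive y (1 : R) (fun y => y * cutoff u1 u2 (N x y))
    (cutoff u1 u2 (N x y) + y * (dcutoff u1 u2 (N x y) * (2 * y))).
  refine (is_derive_eq (is_deriveM (is_derive_id y (1 : R)) (dc' x y)) _).
  by rewrite /GRing.scale /=; ring.
have r1 := is_rderE (is_rder1 z cutfieldE d1 d2).
have r2 := is_rderE (is_rder_i z cutfieldE e1 e2).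
rewrite /d_zbar r1 r2 sqr_modC.
set D := dcutoff _ _ _; set c := cutoff _ _ _.
suff -> : mkC (c + reC z * (D * (2 * reC z))) (imC z * (D * (2 * reC z))) +
    iC R * mkC (reC z * (D * (2 * imC z))) (c + imC z * (D * (2 * imC z)))
    = 2%:R * (z ^+ 2 * toC D) by rewrite mulrC mulKf// pnatr_eq0.
rewrite -toC_nat expr2.
by apply: eqC; rewrite !(reCD, imCD, reCM, imCM) /=; ring.
Qed.

End CutoffField.

Lemma le_modC_monomial (R : realType) (A z1 w1 z2 w2 z3 w3 : Cx R) p q :
  modC z1 ^+ p * modC w1 ^+ q
    <= modC z2 ^+ p * modC w2 ^+ q + modC z3 ^+ p * modC w3 ^+ q ->
  modC (A * z1 ^+ p * w1 ^+ q)
    <= modC (A * z2 ^+ p * w2 ^+ q) + modC (A * z3 ^+ p * w3 ^+ q).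
Proof.
have E (x y : Cx R) : modC (A * x ^+ p * y ^+ q) = modC A * (modC x ^+ p * modC y ^+ q).
  by rewrite modCM modCM modCX modCX mulrA.
by rewrite (E z1 w1) (E z2 w2) (E z3 w3) -mulrDr => H; rewrite ler_wpM2l ?modC_ge0.
Qed.

Section Pairing.
Variable R : realType.
Local Notation C := (Cx R).
Variables (n m : nat) (F : st_family R n m).
Variables (S' : set 'rV[C]_n) (r : R) (hS' : restricted F S' r).
Implicit Types (b v : stspace R n m) (phi : qsection F S' r).

Let c := fam_c F.
Let c_gt0 : 0 < c. Proof. exact: fam_c_gt0. Qed.
Let c_lt1 : c < 1. Proof. exact: fam_c_lt1. Qed.
Let c2_gt0 : 0 < c ^+ 2. Proof. exact: exprn_gt0. Qed.
Let c2c : c ^+ 2 < c. Proof. by rewrite expr2 gtr_pMr. Qed.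

(** The squared inner radius of [core], from |t_k / z| <= c^2; [u2] is the squared outer radius. *)
Let u1 b k := (modC (t_ b k) / c ^+ 2) ^+ 2.
Let u2 : R := (c ^+ 2) ^+ 2.

Lemma base_mod_lt b k : base S' r b -> modC (t_ b k) < r.
Proof. by move=> [_ /(_ k)]; rewrite normCE ltC_toC. Qed.

Let mod_lt b k : base S' r b -> modC (t_ b k) < (c ^+ 2) ^+ 2.
Proof.
move=> /base_mod_lt -/(_ k) H; have [_ _ _ _ /andP[_ rc]] := hS'.
by rewrite (lt_le_trans H)// (le_trans rc)// -exprM.
Qed.

Let u1_gt0 b k : t_ b k != 0 -> 0 < u1 b k.
Proof. by move=> t0; rewrite exprn_gt0// divr_gt0// modC_gt0. Qed.

Let W_lt b k : base S' r b -> modC (t_ b k) / c ^+ 2 < c ^+ 2.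
Proof. by move=> /mod_lt -/(_ k); rewrite ltr_pdivrMr// -expr2. Qed.

Let W_ge0 b k : 0 <= modC (t_ b k) / c ^+ 2.
Proof. by rewrite divr_ge0 ?modC_ge0// ltW. Qed.

Let u1u2 b k : base S' r b -> u1 b k < u2.
Proof.
by move=> /W_lt -/(_ k) H; rewrite /u1 /u2 ltr_pXn2r ?nnegrE ?W_ge0 ?ltW.
Qed.

Let u2_le1 : u2 <= 1.
Proof. by rewrite /u2 -exprM exprn_ile1 // ltW. Qed.

Lemma coreE b k : t_ b k != 0 -> core F b k = annulus (u1 b k) u2.
Proof.
move=> t0; apply/seteqP; split => z; rewrite /core /annulus /= !normCE !leC_toC -/c
  modCM modCV.
- move=> [z0 zc tz]; rewrite /u1 /u2 !ler_pXn2r ?nnegrE ?modC_ge0 ?W_ge0 ?(ltW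
    c2_gt0)//.
  by rewrite zc andbT ler_pdivrMr// mulrC -ler_pdivrMr ?modC_gt0.
- move=> /andP[uz zu]; have z0 : z != 0.
    by rewrite -modC_eq0 -sqrf_eq0 gt_eqF// (lt_le_trans (u1_gt0 t0)).
  move: uz zu; rewrite /u1 /u2 !ler_pXn2r ?nnegrE ?modC_ge0 ?W_ge0 ?(ltW c2_gt0)// =>
    uz zu.
  by split=> //; rewrite ler_pdivrMr ?modC_gt0// mulrC -ler_pdivrMr.
Qed.

Lemma core_near_node b k z : base S' r b -> core F b k z ->
  near_node F S' r z (t_ b k / z) b.
Proof.
move=> hb [z0 zc tz]; have cc : toC (c ^+ 2) < toC c by rewrite ltC_toC.
split => //; [exact: le_lt_trans zc cc|exact: le_lt_trans tz cc|].
by rewrite mulrC divfK//; case: hb.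
Qed.

(** Absolute convergence is given pointwise in (z, w), whereas dominated convergence needs one bound
    over the whole core. It is taken from the points (c^2, |t_k| / c^2) and (|t_k| / c^2, c^2),
    whose coordinates have product |t_k| < r. *)
Lemma coef_bound phi b k : base S' r b -> exists M : R, forall z N, core F b k z ->
  \sum_(p < N) \sum_(q < N) modC (qs_coef phi k p q b * z ^+ p * (t_ b k / z) ^+ q) <=
    M.
Proof.
move=> hb; set T := modC (t_ b k); set W := T / c ^+ 2.
have W0 : 0 <= W by exact: W_ge0.
have TW : T = c ^+ 2 * W by rewrite mulrC divfK// gt_eqF.
have near1 : near_node F S' r (toC (c ^+ 2)) (toC W) b.
  split => //; rewrite ?normrM !normCE !modC_toC ?W_ge0 ?(ltW c2_gt0)// -?toCM
    ltC_toC//.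
    exact: lt_trans (W_lt _ hb) c2c.
  by rewrite -TW base_mod_lt.
have near2 : near_node F S' r (toC W) (toC (c ^+ 2)) b.
  have [? ? ? ?] := near1; split => //; by rewrite mulrC.
have [M1 HM1] := qs_node_abs phi k near1; have [M2 HM2] := qs_node_abs phi k near2.
exists (reC M1 + reC M2) => z N [z0 zc tz].
(* By log-convexity, a monomial is bounded on the core by its values on the two
   boundary circles, where the absolute convergence hypothesis applies. *)
have conv (x y : R) p q : 0 <= x -> 0 <= y -> x * y = T -> x <= c ^+ 2 -> y <= c ^+ 2 ->
    x ^+ p * y ^+ q <= (c ^+ 2) ^+ p * W ^+ q + W ^+ p * (c ^+ 2) ^+ q.
  have C0 : 0 <= c ^+ 2 by exact: ltW.
  (* By symmetry q <= p; then x^p y^q = x^(p-q) T^q, where x <= c^2 and T = c^2 W, so the first term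
     on the right already dominates. *)
  wlog qp : x y p q / (q <= p)%N.
    move=> H x0 y0 xy xc yc; have [qp|/ltnW pq] := leqP q p; first exact: H.
    rewrite mulrC addrC [X in X + _]mulrC [X in _ + X]mulrC.
    by apply: H => //; rewrite mulrC.
  move=> x0 y0 xy xc yc.
  rewrite -(subnK qp) !exprD -!mulrA -!exprMn xy -TW.
  rewrite (@le_trans _ _ ((c ^+ 2) ^+ (p - q) * T ^+ q))//.
    by rewrite ler_wpM2r ?exprn_ge0 ?modC_ge0// lerXn2r// nnegrE.
  by rewrite lerDl; apply: mulr_ge0; apply: exprn_ge0 => //; exact: mulr_ge0.
have toR (a : nat -> nat -> C) (M : C) : (\sum_(p < N) \sum_(q < N) `|a p q| <= M) ->
    \sum_(p < N) \sum_(q < N) modC (a p q) <= reC M.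
  have -> : \sum_(p < N) \sum_(q < N) `|a p q| = toC (\sum_(p < N) \sum_(q < N) modC (a
    p q)).
    rewrite toC_sum; apply: eq_bigr => p _.
    by rewrite toC_sum; apply: eq_bigr => q _; exact: normCE.
  by case: M => M1' M2'; rewrite lecE /= => /andP[].
have H1 := toR (fun p q => qs_coef phi k p q b * toC (c ^+ 2) ^+ p * toC W ^+ q) _ (HM1
  N).
have H2 := toR (fun p q => qs_coef phi k p q b * toC W ^+ p * toC (c ^+ 2) ^+ q) _ (HM2
  N).
apply: le_trans (lerD H1 H2); rewrite -big_split /=; apply: ler_sum => p _.
rewrite -big_split /=; apply: ler_sum => q _.
apply: le_modC_monomial; rewrite (modC_toC W0) (modC_toC (ltW c2_gt0)).
move: zc tz; rewrite !normCE !leC_toC => zc tz.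
apply: conv; rewrite ?modC_ge0//.
by rewrite -modCM mulrC divfK.
Qed.

(** Where the cutoff is 1 this is the z-velocity a_k z / t_k of the motion with w fixed; where it is
    0, z is fixed and w carries the motion. *)
Definition collar_field (a : 'I_m -> C) b (k : 'I_m) (z : C) : C :=
  a k / t_ b k * cutfield (u1 b k) u2 z.

(** The z^2 in the dbar of the field cancels against (2/z)^2, and the 4 left over cancels the 1/4 of
    [annulus_integral]. *)
Lemma integral_core phi b k (a : 'I_m -> C) (L : C) : base S' r b -> t_ b k != 0 ->
  has_Laur phi k b L ->
  has_integral (core F b k)
    (fun z => KS_core (collar_field a b) k z *
              (qs_node phi k z (t_ b k / z) b * (2%:R / z) ^+ 2))
    (- toC pi * (a k / t_ b k) * L).
Proof.
move=> hb t0 hL; have [M HM] := coef_bound phi k hb.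
have mA : measC (core F b k) by rewrite coreE//; exact: annulus_meas.
have H : has_integral (core F b k)
    (fun z => toC (dcutoff (u1 b k) u2 (modC z ^+ 2)) * qs_node phi k z (t_ b k / z) b)
    (- toC pi / 4%:R * L).
  have cf z : annulus (u1 b k) u2 z -> (fun N => \sum_(p < N) \sum_(q < N)
      qs_coef phi k p q b * z ^+ p * (t_ b k / z) ^+ q : C) N @[N --> \oo] -->
      (qs_node phi k z (t_ b k / z) b : C).
    by rewrite -(coreE t0) => Az; exact: (qs_node_series (core_near_node hb Az)).
  have bf z N : annulus (u1 b k) u2 z -> \sum_(p < N) \sum_(q < N)
      modC (qs_coef phi k p q b * z ^+ p * (t_ b k / z) ^+ q) <= M.
    by rewrite -(coreE t0); exact: HM.
  rewrite (coreE t0).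
  exact: (@annulus_integral _ _ _ (u1_gt0 t0) (u1u2 k hb) u2_le1 (t_ b k)
    (fun p q => qs_coef phi k p q b) (fun z => qs_node phi k z (t_ b k / z) b) M L cf
      bf hL).
have := has_integral_lin (4%:R * (a k / t_ b k)) mA H (has_integral0 _).
rewrite (_ : _ * _ + 0 = - toC pi * (a k / t_ b k) * L); last by field.
apply: (eq_has_integral mA) => z [z0 _ _].
rewrite /KS_core /collar_field d_zbarZ; last first.
  exact: (smooth_rderivable (smexpC_smooth setT (smexpC_cutfield _ _)) I).
by rewrite d_zbar_cutfield; field; rewrite z0 t0.
Qed.

Lemma smooth_cst U (a : C) : smooth U (fun=> a).
Proof.
apply: smexpC_smooth; exists (fun _ _ => reC a), (fun _ _ => imC a).
by split => [||z]; [exact: smexp_cst|exact: smexp_cst|case: a].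
Qed.

(** The outer overlap has |z| > c^2, so the cutoff is 0 and [al k] is 0. The inner one has |z| <
    |t_k| / c^2, so the cutoff is 1 and [al k z] times t_k / z is exactly a_k, leaving no
    w-component. Both agree with the zero field on the bulk. *)
Lemma lift_collar b (a : 'rV[C]_m) : base S' r b -> (forall k, t_ b k != 0) ->
  @Defs.lift R n m F b (0, a) (fun _ _ => 0) (collar_field (a 0) b).
Proof.
move=> hb t0; split.
- by move=> d hd; exact: smooth_cst.
- by move=> d e hd he p Ap dp ep g'; rewrite !mul0r.
- move=> k.
  have := smooth_lin (a 0 k / t_ b k) (@open_collar R n m F b k)
    (smexpC_smooth _ (smexpC_cutfield (u1 b k) u2)) (@smooth_cst _ 0).
  by congr smooth; apply/funext => z; rewrite [LHS]addr0.
- move=> k z _ [cz _]; rewrite /collar_field /cutfield cutoff0 ?mulr0//.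
  move: cz; rewrite normCE ltC_toC => /ltW; rewrite -(@ler_pXn2r _ 2)// ?nnegrE
    ?modC_ge0//.
  exact: ltW.
- move=> k z [z0 _ _] [cz _]; rewrite mul0r addr0 /collar_field /cutfield (cutoff1
    (u1u2 k hb)).
    suff : a 0 k / t_ b k * (z * 1) * (t_ b k / z) = a 0 k by [].
    by field; rewrite z0 t0.
  move: cz; rewrite normCE ltC_toC modCM modCV ltr_pdivlMr ?modC_gt0// => cz.
  rewrite /u1 ler_pXn2r ?nnegrE ?modC_ge0 ?W_ge0//.
  by rewrite ler_pdivlMr// mulrC ltW.
Qed.

(** * Linearity of the pairing in the tangent vector *)

Lemma has_surface_integral_lin (A : set F) (a : C) (f g : field F) (v w : C) :
  open A -> has_surface_integral A f v -> has_surface_integral A g w ->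
  has_surface_integral A (fun c z => a * f c z + g c z) (a * v + w).
Proof.
move=> oA [x [fx ->]] [y [gy ->]]; exists (fun i => a * x i + y i); split.
  by move=> i; apply: has_integral_lin => //; exact: measC_cell.
by rewrite mulr_sumr -big_split.
Qed.

Lemma eq_has_surface_integral (A : set F) (f g : field F) (v : C) : open A ->
  (forall d, holo_chart d -> forall z, chart_part d A z -> f d z = g d z) ->
  has_surface_integral A f v -> has_surface_integral A g v.
Proof.
move=> oA fg [x [fx ->]]; exists x; split => // i.
apply: eq_has_integral (fx i); first exact: measC_cell.
by move=> z [Iz [_ Az]]; apply: fg; first exact: rs_atlas_holo.
Qed.

Let oB : open (@bulk R n m F). Proof. exact: open_bulk. Qed.

Lemma nu_lin (a : C) (s s' : 'rV[C]_n) (d : chart R F) z :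
  nu_ (a *: s + s') d z = a * nu_ s d z + nu_ s' d z :> C.
Proof.
rewrite /nu_ mulr_sumr -big_split; apply: eq_bigr => j _ /=.
by rewrite !mxE mulrDl mulrA.
Qed.

Lemma KS_bulk_lin b (a : C) v v' (V V' : field F) (d : chart R F) (z : C) :
  holo_chart d -> chart_part d (@bulk R n m F) z ->
  smooth_field (@bulk R n m F) V -> smooth_field (@bulk R n m F) V' ->
  KS_bulk b (a *: v + v') (fun d z => a * V d z + V' d z) d z =
  a * KS_bulk b v V d z + KS_bulk b v' V' d z.
Proof.
move=> hd Bz sV sV'; rewrite /KS_bulk /dbar_s.
have dV := smooth_rderivable (sV d hd) Bz; have dV' := smooth_rderivable (sV' d hd) Bz.
rewrite (d_zbar_lin a dV dV') (d_z_lin a dV dV') (_ : s_ _ = a *: s_ v + s_ v')//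
  nu_lin.
ring.
Qed.

(** The conditions on a lift are linear in (v, V, al), so the combination of the two given lifts is
    a lift of the combination, with a Kodaira-Spencer representative that combines likewise. *)
Lemma pairing_lin b v v' phi (a x x' : C) : (forall k, t_ b k != 0) ->
  pairing b v phi x -> pairing b v' phi x' ->
  pairing b (a *: v + v') phi (a * x + x').
Proof.
move=> t0 [V [al [[sV tV sal e1 e2] [x0 [x_ [hx hx_ ->]]]]]].
move=> [V' [al' [[sV' tV' sal' e1' e2'] [x0' [x_' [hx' hx_' ->]]]]]].
exists (fun d z => a * V d z + V' d z), (fun k z => a * al k z + al' k z); split.
  split.
  - move=> d hd; apply: smooth_lin; [|exact: sV|exact: sV'].
    by apply: open_chart_part oB; case: hd.
  - move=> d e hd he p Bp dp ep g'.
    by rewrite (tV d e hd he p Bp dp ep) (tV' d e hd he p Bp dp ep) -/g' !mulrDl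
      -!mulrA.
  - by move=> k; apply: smooth_lin; [exact: open_collar|exact: sal|exact: sal'].
  - by move=> k z cz oz; rewrite e1// e1'.
  - move=> k z cz oz; have <- : a * t_ v k + t_ v' k = t_ (a *: v + v') k.
      by rewrite /t_ /= !mxE.
    by rewrite -(e2 k z cz oz) -(e2' k z cz oz); ring.
exists (a * x0 + x0'), (fun k => a * x_ k + x_' k); split.
- apply: (eq_has_surface_integral oB _ (has_surface_integral_lin a oB hx hx')) => d hd
    z Bz.
  by rewrite KS_bulk_lin//; ring.
- move=> k; have mA : measC (core F b k) by rewrite coreE//; exact: annulus_meas.
  apply: (eq_has_integral mA _ (has_integral_lin a mA (hx_ k) (hx_' k))) => z [z0 zc
    tz].
  have cz : collar F b k z.
    have cc : toC (c ^+ 2) < toC c by rewrite ltC_toC.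
    by split => //; [exact: le_lt_trans zc cc|exact: le_lt_trans tz cc].
  rewrite /KS_core (d_zbar_lin a (smooth_rderivable (sal k) cz) (smooth_rderivable
    (sal' k) cz)).
  by ring.
- rewrite big_split /= -mulr_sumr; ring.
Qed.

(** A single lift moves all the collars at once; the bulk contributes 0, as both the vertical field
    and the s-component vanish. *)
Lemma pairing_dt b (a : 'rV[C]_m) phi (L : 'I_m -> C) : base S' r b ->
  (forall k, t_ b k != 0) -> (forall k, has_Laur phi k b (L k)) ->
  pairing b (0, a) phi (\sum_k - toC pi * (a 0 k / t_ b k) * L k).
Proof.
move=> hb t0 hL; exists (fun _ _ => 0), (collar_field (a 0) b); split.
  exact: lift_collar.
exists 0, (fun k => - toC pi * (a 0 k / t_ b k) * L k); split; last by rewrite add0r.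
- apply: (@eq_has_surface_integral _ (fun _ _ => 0)) => // [d hd z Bz|].
    rewrite /KS_bulk /dbar_s d_zbar_cst d_z_cst /nu_ big1 => [|j _];
      last by rewrite mxE mul0r.
    by rewrite !mulr0 !subr0 addr0 mul0r.
  by exists (fun=> 0); split => [i|]; [exact: has_integral0|rewrite big1].
- by move=> k; exact: integral_core.
Qed.

Lemma pairing_decomp b v phi (x : 'I_n -> C) (L : 'I_m -> C) : base S' r b ->
  (forall k, t_ b k != 0) -> (forall k, has_Laur phi k b (L k)) ->
  (forall h, pairing b (d_ds R m h) phi (x h)) ->
  pairing b v phi (\sum_h v.1 0 h * x h + \sum_k - toC pi * (v.2 0 k / t_ b k) * L k).
Proof.
move=> hb t0 hL hx.
(* The induction starts from the d/dt part and adds one d/ds_h at a time by linearity. *)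
have H (s : seq 'I_n) : pairing b (\sum_(h <- s) v.1 0 h *: d_ds R m h + (0, v.2)) phi
    (\sum_(h <- s) v.1 0 h * x h + \sum_k - toC pi * (v.2 0 k / t_ b k) * L k).
  elim: s => [|h s IH]; first by rewrite !big_nil !add0r; exact: pairing_dt.
  by rewrite !big_cons -!addrA; exact: pairing_lin.
have := H (index_enum 'I_n); congr pairing.
have -> : \sum_h v.1 0 h *: d_ds R m h = (v.1, 0) :> stspace R n m.
  rewrite {2}(row_sum_delta v.1); elim: (index_enum _) => [|h s IH].
    by rewrite !big_nil.
  by rewrite !big_cons IH; congr pair; rewrite /= scaler0 addr0.
by rewrite [RHS]surjective_pairing; congr pair; rewrite /= ?addr0 ?add0r.
Qed.

End Pairing.

Theorem corollary14 (R : realType) (n m : nat) (F : st_family R n m)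
    (S' : set 'rV[Cx R]_n) (r : R) (hS' : restricted F S' r)
    (phi : 'I_(n + m) -> qsection F S' r) (hphi : first_frame phi) :
  exists eta : 'I_(n + m) -> stspace R n m -> stspace R n m,
    [/\ (forall j, form_of (phi j) (eta j)),
        (forall U : set (stspace R n m), open U -> U `<=` base S' r ->
           forall theta, generated eta U theta <-> log_cotangent U theta)
      & exists psi : 'I_m -> stspace R n m -> stspace R n m,
          [/\ (forall k b, base S' r b -> differentiable (psi k) b),
              (forall k b, base S' r b -> ~ Ddiv b ->
                 psi k b = t_ b k *: eta (rshift n k) b)
            & forall b, base S' r b -> (forall k, Dk k b) ->
                forall xi, conormal xi <->
                  exists l : 'rV[Cx R]_m, xi = \sum_k l 0 k *: psi k b]].
Proof.
have t0 (b : stspace R n m) : ~ Ddiv b -> forall k, t_ b k != 0 :> Cx R.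
  by move=> nD k; apply/eqP => tk; apply: nD; exists k.
have [dsl dsr Ll Lr] := hphi.
have cdtE (b : stspace R n m) k : ev (cdt R n k) b = b.2 0 k.
  rewrite /ev /= big1 ?add0r => [|h _]; last by rewrite mxE mul0r.
  rewrite (bigD1 k)//= mxE !eqxx mul1r big1 ?addr0// => l lk.
  by rewrite mxE (negPf lk) andbF mul0r.
have cdt_sum (a : 'rV[Cx R]_m) : \sum_k a 0 k *: cdt R n k = (0, a) :> stspace R n m.
  rewrite {2}(row_sum_delta a); elim: (index_enum _) => [|k s IH].
    by rewrite !big_nil.
  by rewrite !big_cons IH; congr pair; rewrite /= scaler0 add0r.
(* Once the frame is identified with ds_h and dt_k / t_k themselves, the statement on the
   log-cotangent sheaf holds by definition. At t_k = 0 the inverse takes its default value 0, but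
   forms are compared off the divisor. *)
exists (@log_generators R n m); split.
- move=> j b hb nD v; rewrite /log_generators.
  case: fintype.splitP => [h|k] jE.
  + have -> : j = lshift m h by apply: val_inj.
    have := pairing_decomp hS' v hb (t0 b nD) (fun k => Ll b hb k h) (fun i => dsl b hb
      nD i h).
    congr pairing; rewrite [X in _ + X]big1 ?addr0 => [|k _]; last by rewrite mulr0.
    rewrite /ev /= [X in _ = _ + X]big1 ?addr0 => [|k _]; last by rewrite mxE mul0r.
    by apply: eq_bigr => i _; rewrite mxE /= mulrC.
  + have -> : j = rshift n k by apply: val_inj.
    have := pairing_decomp hS' v hb (t0 b nD) (fun l => Lr b hb l k) (fun i => dsr b hb
      nD i k).
    congr pairing; rewrite big1 ?add0r => [|i _]; last by rewrite mulr0.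
    rewrite /ev /= [X in _ = X + _]big1 ?add0r => [|i _];
      last by rewrite !mxE mulr0 mul0r.
    apply: eq_bigr => l _; rewrite !mxE /=.
    have p0 : toC (pi : R) != 0 by rewrite toC_eq0 gt_eqF// pi_gt0.
    have [->|lk] := eqVneq l k; last by rewrite !mulr0 mul0r oppr0 mul0r mulr0.
    (* The normalization -1/pi of the frame cancels the factor -pi of the collar integral. *)
    change (- toC pi * (v.2 0 k / t_ b k) * (- 1 / toC pi) = (t_ b k)^-1 * 1 * v.2 0 k
      :> Cx R).
    by field; rewrite p0 t0.
- by [].
(* Off the divisor t_k (dt_k / t_k) = dt_k, a constant form that extends across it. *)
- exists (fun k _ => cdt R n k); split.
  + by move=> k b _; exact: differentiable_cst.
  + move=> k b hb nD; rewrite /log_generators.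
    case: fintype.splitP => [h|l] jE.
      by have := ltn_ord h; rewrite -jE /= ltnNge leq_addr.
    have -> : l = k by apply: val_inj; apply: (@addnI n); rewrite -jE.
    by rewrite scalerA mulfV ?scale1r// t0.
  + move=> b hb Db xi; split.
    * move=> cxi; exists xi.2.
      rewrite cdt_sum.
      suff x1 : xi.1 = 0 by rewrite [LHS]surjective_pairing x1.
      apply/rowP => h; rewrite mxE.
      (* The vector d/ds_h is tangent to every D_k, so a conormal covector has no ds_h component. *)
      have : ev xi (d_ds R m h) = 0 by apply: cxi => k; rewrite cdtE mxE.
      rewrite /ev /=.
      rewrite [X in _ + X]big1 ?addr0 => [|k _]; last by rewrite mxE mulr0.
      rewrite (bigD1 h)//= mxE !eqxx mulr1 big1 ?addr0 => [|i ih]; last first.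
        by rewrite mxE (negPf ih) andbF mulr0.
      exact.
    * move=> [l ->] v hv; rewrite cdt_sum /ev /= !big1 ?addr0// => [k _|h _].
        by rewrite -cdtE hv mulr0.
      by rewrite mxE mul0r.
Qed.
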